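(* Let $\Omega\subseteq\mathbb{H}$ be a non-empty circular domain, let $f\in\mathcal{SR}(\Omega)$, and put $\mathcal{Z}=\{n^2\pi^2 : n\in\mathbb{Z}\setminus\{0\}\}$. Then (i) $\exp_*(f)\in\mathcal{SR}_{\mathbb{R}}(\Omega)$ if and only if either $f_v\equiv0$ or $f_v^s$ is a constant which belongs to $\mathcal{Z}$; (ii) there exists $J\in\mathbb{S}$ such that $\exp_*(f)\in\mathcal{SR}_J(\Omega)\setminus\mathcal{SR}_{\mathbb{R}}(\Omega)$ if and only if $f_v\in\mathcal{SR}_J(\Omega)$ and it is not a constant which belongs to $\mathbb{Z}\pi J$ (that is, for $J\in\mathbb{S}$, $\exp_*(f)\in\mathcal{SR}_J(\Omega)\setminus\mathcal{SR}_{\mathbb{R}}(\Omega)$ if and only if $f_v\in\mathcal{SR}_J(\Omega)$ and $f_v$ is not a constant of the form $n\pi J$, $n\in\mathbb{Z}$).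
   Context: $\mathbb{H}$ is the algebra of quaternions (with the Euclidean topology of $\mathbb{R}^4$), with conjugation $q\mapsto q^c$, $\mathbb{S}=\{q\in\mathbb{H}: q^2=-1\}$, and $\mathbb{C}_J=\mathrm{Span}_{\mathbb{R}}(1,J)$ for $J\in\mathbb{S}$. For $D\subseteq\mathbb{C}=\{\alpha+\imath\beta:\alpha,\beta\in\mathbb{R}\}$ invariant under complex conjugation, $\Omega_D=\{\alpha+\beta I:\alpha+\imath\beta\in D,\ I\in\mathbb{S}\}$; sets of this form are called circular, and a circular domain is a connected open circular subset of $\mathbb{H}$. A stem function is $F=F_1+\imath F_2:D\to\mathbb{H}\otimes_{\mathbb{R}}\mathbb{C}$ ($F_1,F_2$ $\mathbb{H}$-valued) with $F(\overline z)=\overline{F(z)}$, where $\overline{p+\imath q}=p-\imath q$. It induces the slice function $f=\mathcal{I}(F):\Omega_D\to\mathbb{H}$, $f(\alpha+\beta I)=F_1(\alpha+\imath\beta)+I F_2(\alpha+\imath\beta)$. On a circular domain $\Omega=\Omega_D$, $f=\mathcal I(F)$ is slice-regular if $F$ is holomorphic for the natural complex structures of $\mathbb{C}$ and $\mathbb{H}\otimes_{\mathbb{R}}\mathbb{C}$; $\mathcal{SR}(\Omega)$ is the set of slice-regular functions, $\mathcal{SR}_{\mathbb{R}}(\Omega)$ is the subset of slice-preserving ones, i.e. those with $F_1,F_2$ real-valued, and, for $J\in\mathbb{S}$, $\mathcal{SR}_J(\Omega)$ is the subset of $\mathbb{C}_J$-preserving ones, i.e. those with $F_1,F_2$ $\mathbb{C}_J$-valued.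 The $*$-product is $\mathcal I(F)*\mathcal I(G)=\mathcal I(FG)$, with $(p+\imath q)(p'+\imath q')=pp'-qq'+\imath(pq'+qp')$. For $f=\mathcal I(F_1+\imath F_2)\in\mathcal{SR}(\Omega)$: $f^c=\mathcal I(F_1^c+\imath F_2^c)$, $f_v=\frac{f-f^c}{2}$, $f^s=f*f^c$, and $f_v^s$ means $(f_v)^s$. The $*$-exponential is $\exp_*(f)=\sum_{n\in\mathbb{N}}\frac{f^{*n}}{n!}$ ($f^{*n}$ the $n$-th $*$-power, $f^{*0}=1$), which converges uniformly on compact subsets of $\Omega$ to an element of $\mathcal{SR}(\Omega)$. *)

(* Defs.v *)
From HB Require Import structures.
From mathcomp Require Import all_boot all_order all_algebra.
From mathcomp Require Import ring lra.
From mathcomp Require Import all_classical all_reals all_analysis.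

Set Implicit Arguments.
Unset Strict Implicit.
Unset Printing Implicit Defensive.

Import Order.TTheory GRing.Theory Num.Theory.
Import numFieldNormedType.Exports.

Local Open Scope classical_set_scope.
Local Open Scope ring_scope.

(* The quaternion  a + b i + c j + d k  is  Quat a b c d. *)
Record quat (R : realType) : Type :=
  Quat { qa : R ; qb : R ; qc : R ; qd : R }.

Section QuatAlgebra.
Variable R : realType.
Implicit Types p q r : quat R.

Definition quat_tuple q := (qa q, qb q, qc q, qd q).
Definition tuple_quat (t : R * R * R * R) : quat R :=
  let: (a, b, c, d) := t in Quat a b c d.

Lemma quat_tupleK : cancel quat_tuple tuple_quat.
Proof. by case. Qed.

Lemma quat_eq p q :
  qa p = qa q -> qb p = qb q -> qc p = qc q -> qd p = qd q -> p = q.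
Proof. by case: p q => ? ? ? ? [? ? ? ?] /= -> -> -> ->. Qed.

HB.instance Definition _ := Choice.copy (quat R) (can_type quat_tupleK).

Definition addq p q :=
  Quat (qa p + qa q) (qb p + qb q) (qc p + qc q) (qd p + qd q).
Definition oppq p := Quat (- qa p) (- qb p) (- qc p) (- qd p).
Definition mulq p q := Quat
  (qa p * qa q - qb p * qb q - qc p * qc q - qd p * qd q)
  (qa p * qb q + qb p * qa q + qc p * qd q - qd p * qc q)
  (qa p * qc q - qb p * qd q + qc p * qa q + qd p * qb q)
  (qa p * qd q + qb p * qc q - qc p * qb q + qd p * qa q).
Definition scaleq (x : R) q := Quat (x * qa q) (x * qb q) (x * qc q) (x * qd q).

Lemma addqA : associative addq.
Proof. by case=> ? ? ? ? [? ? ? ?] [? ? ? ?]; rewrite /addq /= !addrA. Qed.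
Lemma addqC : commutative addq.
Proof.
case=> a b c d [a' b' c' d']; rewrite /addq /=.
by rewrite (addrC a) (addrC b) (addrC c) (addrC d).
Qed.
Lemma add0q : left_id (Quat 0 0 0 0) addq.
Proof. by case=> ? ? ? ?; rewrite /addq /= !add0r. Qed.
Lemma addNq : left_inverse (Quat 0 0 0 0) oppq addq.
Proof. by case=> ? ? ? ?; rewrite /addq /= !addNr. Qed.

HB.instance Definition _ :=
  GRing.isZmodule.Build (quat R) addqA addqC add0q addNq.

Lemma mulqA : associative mulq.
Proof.
by case=> ? ? ? ? [? ? ? ?] [? ? ? ?]; rewrite /mulq /=; congr Quat; ring.
Qed.
Lemma mul1q : left_id (Quat 1 0 0 0) mulq.
Proof. by case=> ? ? ? ?; rewrite /mulq /=; congr Quat; ring. Qed.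
Lemma mulq1 : right_id (Quat 1 0 0 0) mulq.
Proof. by case=> ? ? ? ?; rewrite /mulq /=; congr Quat; ring. Qed.
Lemma mulqDl : left_distributive mulq +%R.
Proof.
case=> ? ? ? ? [? ? ? ?] [? ? ? ?]; rewrite /mulq /=.
by apply: quat_eq; rewrite /=; ring.
Qed.
Lemma mulqDr : right_distributive mulq +%R.
Proof.
case=> ? ? ? ? [? ? ? ?] [? ? ? ?]; rewrite /mulq /=.
by apply: quat_eq; rewrite /=; ring.
Qed.
Lemma oneq_neq0 : Quat 1 0 0 0 != 0 :> quat R.
Proof. by apply/eqP => -[] /eqP; rewrite oner_eq0. Qed.

HB.instance Definition _ := GRing.Zmodule_isNzRing.Build (quat R)
  mulqA mul1q mulq1 mulqDl mulqDr oneq_neq0.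

Lemma scaleqA x y q : scaleq x (scaleq y q) = scaleq (x * y) q.
Proof. by case: q => ? ? ? ?; rewrite /scaleq /= !mulrA. Qed.
Lemma scale1q : left_id 1 scaleq.
Proof. by case=> ? ? ? ?; rewrite /scaleq /= !mul1r. Qed.
Lemma scaleqDr : right_distributive scaleq +%R.
Proof.
by move=> x [? ? ? ?] [? ? ? ?]; apply: quat_eq; rewrite /= mulrDr.
Qed.
Lemma scaleqDl q : {morph scaleq^~ q : x y / x + y}.
Proof.
by case: q => ? ? ? ? x y; apply: quat_eq; rewrite /= mulrDl.
Qed.

HB.instance Definition _ := GRing.Zmodule_isLmodule.Build R (quat R)
  scaleqA scale1q scaleqDr scaleqDl.

Lemma scaleqAl (x : R) p q : x *: (p * q) = (x *: p) * q.
Proof. by case: p q => ? ? ? ? [? ? ? ?]; apply: quat_eq => /=; ring. Qed.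
Lemma scaleqAr (x : R) p q : x *: (p * q) = p * (x *: q).
Proof. by case: p q => ? ? ? ? [? ? ? ?]; apply: quat_eq => /=; ring. Qed.

HB.instance Definition _ :=
  GRing.Lmodule_isLalgebra.Build R (quat R) scaleqAl.
HB.instance Definition _ :=
  GRing.Lalgebra_isAlgebra.Build R (quat R) scaleqAr.

Definition sqnormq q := qa q ^+ 2 + qb q ^+ 2 + qc q ^+ 2 + qd q ^+ 2.
Definition normq q : R := Num.sqrt (sqnormq q).

Lemma sqnormq_ge0 q : 0 <= sqnormq q.
Proof. by rewrite /sqnormq !addr_ge0 // sqr_ge0. Qed.

Lemma normqD p q : normq (p + q) <= normq p + normq q.
Proof.
have N0 r : 0 <= normq r by rewrite sqrtr_ge0.
rewrite -(@ler_pXn2r _ 2) ?nnegrE ?addr_ge0 //.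
rewrite sqrrD !sqr_sqrtr ?sqnormq_ge0 //.
set s := qa p * qa q + qb p * qb q + qc p * qc q + qd p * qd q.
have -> : sqnormq (p + q) = sqnormq p + s *+ 2 + sqnormq q.
  by case: p q @s => ? ? ? ? [? ? ? ?]; rewrite /sqnormq /=; ring.
rewrite lerD2r lerD2l lerMn2r /=.
rewrite (le_trans (ler_norm _)) // -(@ler_pXn2r _ 2) ?nnegrE ?mulr_ge0 //.
rewrite exprMn !sqr_sqrtr ?sqnormq_ge0 // real_normK ?num_real //.
rewrite -subr_ge0 /s /sqnormq; case: p q {s} => a b c d [a' b' c' d'] /=.
set x := (X in 0 <= X).
have -> : x = (a * b' - b * a') ^+ 2 + (a * c' - c * a') ^+ 2
  + (a * d' - d * a') ^+ 2 + (b * c' - c * b') ^+ 2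
  + (b * d' - d * b') ^+ 2 + (c * d' - d * c') ^+ 2 by rewrite /x; ring.
by rewrite !addr_ge0 // sqr_ge0.
Qed.

Lemma normqZ (x : R) q : normq (x *: q) = `|x| * normq q.
Proof.
rewrite -sqrtr_sqr -sqrtrM ?sqr_ge0 //; congr Num.sqrt.
by case: q => ? ? ? ?; rewrite /sqnormq /=; ring.
Qed.

Lemma normq_eq0 q : normq q = 0 -> q = 0.
Proof.
move/eqP; rewrite sqrtr_eq0 => h.
have : sqnormq q == 0 by rewrite eq_le h sqnormq_ge0.
rewrite /sqnormq !paddr_eq0 ?addr_ge0 ?sqr_ge0 // !sqrf_eq0.
by case: q {h} => a b c d /= /andP[/andP[/andP[/eqP-> /eqP->] /eqP->] /eqP->].
Qed.

HB.instance Definition _ :=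
  Lmodule_isNormed.Build R (quat R) normqD normqZ normq_eq0.

Definition conjq q := Quat (qa q) (- qb q) (- qc q) (- qd q).

Definition imq q := q - (qa q)%:A.

Definition imag_units : set (quat R) := [set q | q ^+ 2 = -1].

Definition real_quats : set (quat R) := [set q | exists x : R, q = x%:A].

Definition Cplane (J : quat R) : set (quat R) :=
  [set q | exists x y : R, q = x%:A + y *: J].

End QuatAlgebra.

Section SliceFunctions.
Variable R : realType.

(* (x, y) : R * R stands for  x + \imath y  in the complex plane, and
   (p, q) : quat R * quat R  stands for  p + \imath q  in the complexification
   of the quaternions. *)
Let CC := (R * R)%type.
Let HC := (quat R * quat R)%type.

Definition conjC2 (z : CC) : CC := (z.1, - z.2).
Definition mulI (z : CC) : CC := (- z.2, z.1).

Definition conjHC (w : HC) : HC := (w.1, - w.2).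
Definition mulIHC (w : HC) : HC := (- w.2, w.1).
Definition mulHC (w v : HC) : HC :=
  (w.1 * v.1 - w.2 * v.2, w.1 * v.2 + w.2 * v.1).

Definition conj_invariant (D : set CC) := forall z, D z -> D (conjC2 z).

Definition circularization (D : set CC) : set (quat R) :=
  [set q | exists (x y : R) (I : quat R),
     [/\ D (x, y), imag_units I & q = x%:A + y *: I]].

Definition stem (D : set CC) (F : CC -> HC) :=
  forall z, D z -> F (conjC2 z) = conjHC (F z).

(* [induces D F f] : f restricted to circularization D is I(F). Functions are
   total; their values outside D, resp. circularization D, are never used. *)
Definition induces (D : set CC) (F : CC -> HC) (f : quat R -> quat R) :=
  forall (x y : R) (I : quat R), D (x, y) -> imag_units I ->
    f (x%:A + y *: I) = (F (x, y)).1 + I * (F (x, y)).2.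

(* Real differentiable with complex linear differential. *)
Definition holomorphic (D : set CC) (F : CC -> HC) :=
  forall z, D z -> differentiable F z /\
    forall v : CC, 'd F z (mulI v) = mulIHC ('d F z v).

(* Slice-regular functions whose stem function has both components in A. *)
Definition SR_in (A : set (quat R)) (D : set CC) (f : quat R -> quat R) :=
  exists F : CC -> HC, [/\ stem D F, holomorphic D F, induces D F f &
    forall z, D z -> A (F z).1 /\ A (F z).2].

Definition SR := SR_in setT.
Definition SR_real := SR_in (@real_quats R).
Definition SR_C (J : quat R) := SR_in (Cplane J).

(* I(F). At a real point q the summand with F_2 is 0, as it should be since
   F_2 vanishes there when F is a stem function. *)
Definition slice (F : CC -> HC) (q : quat R) : quat R :=
  (F (qa q, `|imq q|)).1 + (`|imq q|^-1 *: imq q) * (F (qa q, `|imq q|)).2.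

(* The stem function of a slice function, unique on D; see stem_unique. *)
Definition stem_of (D : set CC) (f : quat R -> quat R) : CC -> HC :=
  xget (fun=> (0, 0)) [set F | stem D F /\ induces D F f].

Definition smul (D : set CC) (f g : quat R -> quat R) : quat R -> quat R :=
  slice (fun z => mulHC (stem_of D f z) (stem_of D g z)).

Definition sconj (D : set CC) (f : quat R -> quat R) : quat R -> quat R :=
  slice (fun z => (conjq (stem_of D f z).1, conjq (stem_of D f z).2)).

Definition spow (D : set CC) (f : quat R -> quat R) (n : nat) :
    quat R -> quat R :=
  iter n (smul D f) (fun=> 1).

Definition svec (D : set CC) (f : quat R -> quat R) : quat R -> quat R :=
  fun q => 2^-1 *: (f q - sconj D f q).

Definition ssym (D : set CC) (f : quat R -> quat R) : quat R -> quat R :=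
  smul D f (sconj D f).

(* Pointwise limit; the series converges uniformly on compact sets of the
   circularization of D when f is slice-regular there. *)
Definition sexp (D : set CC) (f : quat R -> quat R) : quat R -> quat R :=
  fun q => lim (series (fun n => (n`!%:R)^-1 *: spow D f n q) @ \oo).

Definition calZ : set R :=
  [set c | exists2 n : int, n != 0 & c = n%:~R ^+ 2 * pi ^+ 2].

Lemma imag_unitsP (I : quat R) : imag_units I -> qa I = 0 /\ normq I = 1.
Proof.
case: I => a b c d [] h1 h2 h3 h4 /=.
have ea : a = 0.
  apply/eqP/negPn/negP => a0.
  have inj x : a * x *+ 2 = 0 -> x = 0.
    by move/eqP; rewrite mulrn_eq0 /= mulf_eq0 (negbTE a0) /= => /eqP.
  have b0 : b = 0 by apply: inj; rewrite oppr0 in h2; rewrite -h2; ring.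
  have c0 : c = 0 by apply: inj; rewrite oppr0 in h3; rewrite -h3; ring.
  have d0 : d = 0 by apply: inj; rewrite oppr0 in h4; rewrite -h4; ring.
  move: h1; rewrite b0 c0 d0 => h1; have := sqr_ge0 a; nra.
split=> //; rewrite /normq /sqnormq /= -[RHS]sqrtr1; congr Num.sqrt.
move: h1; rewrite ea => h1; nra.
Qed.

(* slice F is indeed the function induced by F. *)
Lemma slice_induces (D : set CC) F : stem D F -> induces D F (slice F).
Proof.
move=> sF x y I Dz II; have [I0 nI] := imag_unitsP II.
have ex : qa (x%:A + y *: I) = x by rewrite /= I0 !mulr0 mulr1 addr0.
have ei : imq (x%:A + y *: I) = y *: I by rewrite /imq ex addrC addKr.
rewrite /slice ex ei normrZ.
have -> : `|I| = 1 by exact: nI.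
rewrite mulr1.
have [y0|y0|y0] := ltgtP y 0.
- rewrite ltr0_norm // scalerA invrN mulNr mulVf ?lt_eqF // scaleN1r.
  by have /= := sF _ Dz; rewrite /conjC2 /= => ->; rewrite /= mulrNN.
- by rewrite gtr0_norm // scalerA mulVf ?gt_eqF // scale1r.
- have := sF _ Dz; rewrite /conjC2 /= y0 oppr0 normr0 => e.
  have e2 : (F (x, 0)).2 = - (F (x, 0)).2 by rewrite {1}e.
  suff -> : (F (x, 0)).2 = 0 by rewrite !mulr0.
  apply/eqP; have : (F (x, 0)).2 *+ 2 == 0 by rewrite mulr2n {2}e2 subrr.
  by rewrite -scaler_nat scaler_eq0 pnatr_eq0.
Qed.

Lemma stem_unique (D : set CC) (F G : CC -> HC) (f : quat R -> quat R) :
  induces D F f -> induces D G f -> forall z, D z -> F z = G z.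
Proof.
move=> hF hG [x y] Dz.
have SI : imag_units (Quat 0 1 0 0 : quat R).
  by apply: quat_eq; rewrite /=; ring.
have SNI : imag_units (- Quat 0 1 0 0 : quat R) by rewrite /imag_units /= sqrrN.
have e1 := hF _ _ _ Dz SI; rewrite (hG _ _ _ Dz SI) in e1.
have e2 := hF _ _ _ Dz SNI; rewrite (hG _ _ _ Dz SNI) in e2.
case: (F _) (G _) e1 e2 => [[a b c d] [a' b' c' d']].
case=> [[s t u v] [s' t' u' v']] [] /= A1 A2 A3 A4 [] /= B1 B2 B3 B4.
by congr (Quat _ _ _ _, Quat _ _ _ _); lra.
Qed.

End SliceFunctions.

(* Main.v *)
Require Import Defs.
From HB Require Import structures.
From mathcomp Require Import all_boot all_order all_algebra.
From mathcomp Require Import ring lra.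
From mathcomp Require Import all_classical all_reals all_analysis.
From mathcomp Require Import complex.

Set Implicit Arguments.
Unset Strict Implicit.
Unset Printing Implicit Defensive.

Import Order.TTheory GRing.Theory Num.Theory.
Import numFieldNormedType.Exports.
Import ComplexField.Normc.

Local Open Scope classical_set_scope.
Local Open Scope ring_scope.

(** The stem function F of f takes its values in the complexified quaternions,
    where F = a + v with a complex-valued and v a vector with three complex
    coordinates. Put N = vb^2 + vc^2 + vd^2; this is the stem function of
    the symmetrization of f_v, and v * v = - N. Hence every power of F has
    the form A_n + B_n v with A_n, B_n polynomials in a and N, and summing the
    series gives
      exp(F) = A + B v,  A = (e^(a+m) + e^(a-m)) / 2,
                         B = (e^(a+m) - e^(a-m)) / (2 m),  m^2 = - N
    (B = e^a when m = 0). This is [sexp_induces]. Since B vanishes exactly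
    when m = i n pi with n a nonzero integer, B = 0 forces N = n^2 pi^2
    ([exp_coefB_vnorm]).

    For (i), exp(F) is real exactly when B v = 0, so at each point either
    v = 0, and then N = 0, or N = n^2 pi^2 with n <> 0. Thus N takes
    values in a discrete set of real numbers and is constant because the circular
    domain is connected ([real_const]); conversely both cases make exp(F) equal
    to e^a times a real constant.

    For (ii), if v = u J then N = u^2 and exp(F) = e^a (cos u + J sin u) is
    C_J-valued; if it were real, u would be a constant multiple of pi by the
    same discreteness argument ([Jcomp_const]). Conversely, suppose exp(F) is
    C_J-valued but v leaves the complex line spanned by J at some point. It does so
    on a neighbourhood, where B must vanish, so N is locally equal to
    some n^2 pi^2. By the identity theorem N is equal to it everywhere, and (i)
    says that exp(F) is real ([SR_C_svec]).

    The identity theorem has to be proved for functions that are only assumed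
    complex differentiable at every point ([disc_identity]). Goursat's
    bisection ([goursat]), applied in logarithmic polar coordinates, shows that
    the circular means of a holomorphic function do not depend on the radius, so
    its real part has no strict interior maximum of quadratic type
    ([no_strict_max]). Adding a small multiple of the squared distance turns
    this into the maximum modulus principle ([max_modulus]). If phi vanishes
    near a, then phi(z) / (z - a)^n is still holomorphic, and the maximum
    principle for all n forces phi to vanish on the whole disc. *)

Local Notation Re := complex.Re.
Local Notation Im := complex.Im.

(** * Goursat's theorem on rectangles *)

Section Goursat.
Variable R : realType.
Implicit Types (f g : R -> R) (u v : R * R -> R) (a b c s t : R).

Definition segint f a b := Rintegral (@lebesgue_measure R) `[a, b]%classic f.

Definition cont_on f a b := forall x, a <= x <= b -> {for x, continuous f}.

Lemma cont_on_integrable f a b : cont_on f a b ->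
  (@lebesgue_measure R).-integrable `[a, b]%classic (EFin \o f).
Proof.
move=> cf; apply: continuous_compact_integrable; first exact: segment_compact.
apply: continuous_in_subspaceT => x; rewrite inE /= in_itv /= => h.
exact: cf.
Qed.

Lemma segint_split f a b c : a <= b -> b <= c -> cont_on f a c ->
  segint f a c = segint f a b + segint f b c.
Proof.
move=> ab bc cf; have := cont_on_integrable cf => intf.
have := @Rintegral_itvB R f (BLeft a) (BRight c) b intf.
rewrite !bnd_simp => /(_ ab bc); rewrite Rintegral_itv_obnd_cbnd.
  by rewrite /segint => <-; rewrite addrC subrK.
apply: integrableS intf => //; apply: subset_itvr.
by rewrite bnd_simp.
Qed.

Lemma segintB f g a b : cont_on f a b -> cont_on g a b ->
  segint (fun x => f x - g x) a b = segint f a b - segint g a b.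
Proof. by move=> cf cg; rewrite /segint RintegralB //; exact: cont_on_integrable. Qed.

Lemma segint_cst k a b : a <= b -> segint (fun=> k) a b = k * (b - a).
Proof.
move=> ab; rewrite /segint Rintegral_cst //= lebesgue_measure_itv /= lte_fin.
by case: ltgtP ab => // -> _; rewrite subrr mulr0.
Qed.

Lemma segint_le f g a b : cont_on f a b -> cont_on g a b ->
  (forall x, a <= x <= b -> f x <= g x) -> segint f a b <= segint g a b.
Proof.
move=> cf cg h; apply: le_Rintegral => //; try exact: cont_on_integrable.
Qed.

Lemma segint_near_cst f a b k e : a <= b -> cont_on f a b ->
  (forall x, a <= x <= b -> `|f x - k| <= e) ->
  `|segint f a b - k * (b - a)| <= e * (b - a).
Proof.
move=> ab cf h.
have cc y : cont_on (fun=> y) a b by move=> x _; exact: cst_continuous.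
have h1 : segint f a b <= (k + e) * (b - a).
  rewrite -segint_cst //; apply: segint_le => // x /h; rewrite ler_norml; lra.
have h2 : (k - e) * (b - a) <= segint f a b.
  rewrite -segint_cst //; apply: segint_le => // x /h; rewrite ler_norml; lra.
rewrite ler_norml; lra.
Qed.

Definition cont_rect u s1 s2 t1 t2 :=
  forall s t, s1 <= s <= s2 -> t1 <= t <= t2 -> {for (s, t), continuous u}.

Lemma cont_slice1 u s1 s2 t1 t2 s : cont_rect u s1 s2 t1 t2 ->
  s1 <= s <= s2 -> cont_on (fun t => u (s, t)) t1 t2.
Proof.
move=> cu hs t ht; apply: (@continuous_comp _ _ _ (fun t => (s, t)) u).
  by apply: (@cvg_pair _ _ _ (nbhs t) (nbhs s) (nbhs t)); [exact: cvg_cst | exact: cvg_id].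
exact: cu.
Qed.

Lemma cont_slice2 u s1 s2 t1 t2 t : cont_rect u s1 s2 t1 t2 ->
  t1 <= t <= t2 -> cont_on (fun s => u (s, t)) s1 s2.
Proof.
move=> cu ht s hs; apply: (@continuous_comp _ _ _ (fun s => (s, t)) u).
  by apply: (@cvg_pair _ _ _ (nbhs s) (nbhs s) (nbhs t)); [exact: cvg_id | exact: cvg_cst].
exact: cu.
Qed.

(** The integral of u dt + v ds along the boundary of a rectangle with sides
    parallel to the axes, counterclockwise. *)
Definition flux u v s1 s2 t1 t2 :=
  segint (fun t => u (s2, t) - u (s1, t)) t1 t2 -
  segint (fun s => v (s, t2) - v (s, t1)) s1 s2.

Lemma cont_rectS u s1 s2 t1 t2 s1' s2' t1' t2' : cont_rect u s1 s2 t1 t2 ->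
  s1 <= s1' -> s2' <= s2 -> t1 <= t1' -> t2' <= t2 ->
  cont_rect u s1' s2' t1' t2'.
Proof. by move=> cu *; move=> s t hs ht; apply: cu; lra. Qed.

Lemma fluxE u v s1 s2 t1 t2 : s1 <= s2 -> t1 <= t2 ->
  cont_rect u s1 s2 t1 t2 -> cont_rect v s1 s2 t1 t2 ->
  flux u v s1 s2 t1 t2 =
    segint (fun t => u (s2, t)) t1 t2 - segint (fun t => u (s1, t)) t1 t2 -
    (segint (fun s => v (s, t2)) s1 s2 - segint (fun s => v (s, t1)) s1 s2).
Proof.
move=> hs ht cu cv; rewrite /flux !segintB //;
  by [apply: cont_slice1 cu _; lra | apply: cont_slice2 cv _; lra].
Qed.

Lemma flux_split u v s1 s2 s3 t1 t2 t3 :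
  s1 <= s2 -> s2 <= s3 -> t1 <= t2 -> t2 <= t3 ->
  cont_rect u s1 s3 t1 t3 -> cont_rect v s1 s3 t1 t3 ->
  flux u v s1 s3 t1 t3 = flux u v s1 s2 t1 t2 + flux u v s2 s3 t1 t2
                       + flux u v s1 s2 t2 t3 + flux u v s2 s3 t2 t3.
Proof.
move=> s12 s23 t12 t23 cu cv.
do ![rewrite fluxE; [|lra|lra|by apply: cont_rectS cu _ _ _ _; lra
                        |by apply: cont_rectS cv _ _ _ _; lra]].
have S1 s : s1 <= s <= s3 -> segint (fun t => u (s, t)) t1 t3 =
    segint (fun t => u (s, t)) t1 t2 + segint (fun t => u (s, t)) t2 t3.
  by move=> hs; apply: segint_split => //; apply: cont_slice1 cu _.
have S2 t : t1 <= t <= t3 -> segint (fun s => v (s, t)) s1 s3 =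
    segint (fun s => v (s, t)) s1 s2 + segint (fun s => v (s, t)) s2 s3.
  by move=> ht; apply: segint_split => //; apply: cont_slice2 cv _.
rewrite (S1 s1) ?(S1 s3) ?(S2 t1) ?(S2 t3); [ring|lra..].
Qed.

Lemma is_diff_approx (V : normedModType R) (u : V -> R) p du e :
  is_diff p u du -> 0 < e ->
  exists2 d, 0 < d & forall q, `|q - p| < d ->
    `|u q - u p - du (q - p)| <= e * `|q - p|.
Proof.
move=> dfu e0; have [h <-] := dfu.
have /eqaddoP/(_ e e0) := diff_locally h.
move/nbhs_normP => [d /= d0 hd]; exists d => // q qd.
have := hd (q - p); rewrite /= sub0r normrN => /(_ qd).
by rewrite /= !fctE /= subrK opprD addrA.
Qed.

(** When the partial derivative of u in s equals that of v in t, the linear parts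
    contribute a (s2 - s1) (t2 - t1) twice with opposite signs, so the flux through a
    small rectangle around p is negligible compared with the square of its
    perimeter. *)
Lemma flux_small u v p a b c e :
  is_diff p u (fun w => a * w.1 + b * w.2) ->
  is_diff p v (fun w => c * w.1 + a * w.2) -> 0 < e ->
  exists2 d, 0 < d & forall s1 s2 t1 t2,
    s1 <= p.1 <= s2 -> t1 <= p.2 <= t2 -> s2 - s1 < d -> t2 - t1 < d ->
    cont_rect u s1 s2 t1 t2 -> cont_rect v s1 s2 t1 t2 ->
    `|flux u v s1 s2 t1 t2| <= 2 * e * ((s2 - s1) + (t2 - t1)) ^+ 2.
Proof.
move=> du dv e0.
have [d1 d10 h1] := is_diff_approx du e0.
have [d2 d20 h2] := is_diff_approx dv e0.
exists (Num.min d1 d2); first by rewrite lt_min d10.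
case: p du dv h1 h2 => s0 t0 /= du dv h1 h2 s1 s2 t1 t2 hs ht sd td cu cv.
set D := (s2 - s1) + (t2 - t1).
have D0 : 0 <= D by rewrite /D; lra.
have [d1s d2s] : s2 - s1 < d1 /\ s2 - s1 < d2.
  by move: sd; rewrite lt_min => /andP[].
have [d1t d2t] : t2 - t1 < d1 /\ t2 - t1 < d2.
  by move: td; rewrite lt_min => /andP[].
have nrm s t k : s1 <= s <= s2 -> t1 <= t <= t2 -> s2 - s1 < k -> t2 - t1 < k ->
    `|(s, t) - (s0, t0)| < k /\ `|(s, t) - (s0, t0)| <= D.
  move=> h h' hk hk'; rewrite prod_normE /= gt_max ge_max !ltr_norml !ler_norml.
  by rewrite /D; split; apply/andP; split; lra.
have hu s t : s1 <= s <= s2 -> t1 <= t <= t2 ->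
    `|u (s, t) - u (s0, t0) - (a * (s - s0) + b * (t - t0))| <= e * D.
  move=> h h'; have [n1 n2] := nrm _ _ _ h h' d1s d1t.
  by apply: le_trans (h1 _ n1) _; rewrite ler_wpM2l // ltW.
have hv s t : s1 <= s <= s2 -> t1 <= t <= t2 ->
    `|v (s, t) - v (s0, t0) - (c * (s - s0) + a * (t - t0))| <= e * D.
  move=> h h'; have [n1 n2] := nrm _ _ _ h h' d2s d2t.
  by apply: le_trans (h2 _ n1) _; rewrite ler_wpM2l // ltW.
have cB f g x y : cont_on f x y -> cont_on g x y ->
    cont_on (fun z => f z - g z) x y.
  by move=> cf cg z hz; apply: cvgB; [exact: cf | exact: cg].
have I1 : `|segint (fun t => u (s2, t) - u (s1, t)) t1 t2 -
            (a * (s2 - s1)) * (t2 - t1)| <= (2 * (e * D)) * (t2 - t1).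
  apply: segint_near_cst; first lra.
    by apply: cB; apply: cont_slice1 cu _; lra.
  move=> t h'; have hA := hu s1 t; have hB := hu s2 t.
  have /hA/(_ h') : s1 <= s1 <= s2 by lra.
  have /hB/(_ h') : s1 <= s2 <= s2 by lra.
  rewrite !ler_norml; lra.
have I2 : `|segint (fun s => v (s, t2) - v (s, t1)) s1 s2 -
            (a * (t2 - t1)) * (s2 - s1)| <= (2 * (e * D)) * (s2 - s1).
  apply: segint_near_cst; first lra.
    by apply: cB; apply: cont_slice2 cv _; lra.
  move=> s h'.
  have hA := hv s t1 h'; have hB := hv s t2 h'.
  have /hA : t1 <= t1 <= t2 by lra.
  have /hB : t1 <= t2 <= t2 by lra.
  rewrite !ler_norml; lra.
have -> : 2 * e * D ^+ 2 = 2 * (e * D) * (t2 - t1) + 2 * (e * D) * (s2 - s1).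
  by rewrite /D; ring.
move: I1 I2; rewrite /flux !ler_norml.
set x := segint _ _ _; set y := segint _ _ _; lra.
Qed.

End Goursat.

Section GoursatTheorem.
Variable R : realType.
Implicit Types (u v : R * R -> R) (a b c s t : R).

Lemma half_pow_lt (x d : R) : 0 < d -> exists n, x * 2^-1 ^+ n < d.
Proof.
move=> d0; pose n := Num.bound `|x / d|.
have h : x / d < n%:R.
  exact: le_lt_trans (ler_norm _) (archi_boundP (normr_ge0 _)).
exists n; rewrite exprVn ltr_pdivrMr ?exprn_gt0 // mulrC -ltr_pdivrMr //.
by apply: lt_trans h _; rewrite -natrX ltr_nat ltn_expl.
Qed.

(** No continuity of the derivatives is available, so the flux is bisected: a
    nonzero flux survives, at a rate comparable to the area, in a sequence of nested
    rectangles shrinking to a point, against [flux_small] at that point. *)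
Theorem goursat u v s1 s2 t1 t2 : s1 <= s2 -> t1 <= t2 ->
  (forall s t, s1 <= s <= s2 -> t1 <= t <= t2 -> exists a b c,
     is_diff (s, t) u (fun w => a * w.1 + b * w.2) /\
     is_diff (s, t) v (fun w => c * w.1 + a * w.2)) ->
  flux u v s1 s2 t1 t2 = 0.
Proof.
move=> hs ht hd.
have cu : cont_rect u s1 s2 t1 t2.
  move=> s t h h'; have [a [b [c [du _]]]] := hd s t h h'.
  exact/differentiable_continuous/(@ex_diff _ _ _ _ _ _ _ du).
have cv : cont_rect v s1 s2 t1 t2.
  move=> s t h h'; have [a [b [c [_ dv]]]] := hd s t h h'.
  exact/differentiable_continuous/(@ex_diff _ _ _ _ _ _ _ dv).
apply/eqP/negPn/negP => nz; set e := `|flux u v s1 s2 t1 t2|.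
have e0 : 0 < e by rewrite normr_gt0.
pose A := s2 - s1; pose B := t2 - t1.
have A0 : 0 <= A by rewrite subr_ge0.
have B0 : 0 <= B by rewrite subr_ge0.
pose w n : R := 2^-1 ^+ n.
have w0 n : 0 < w n by rewrite exprn_gt0.
have wS n : w n = 2 * w n.+1 by rewrite /w exprS mulrA divff // mul1r.
pose Good (x : nat * (R * R)) := let: (n, (s, t)) := x in
  [/\ s1 <= s, s + A * w n <= s2, t1 <= t, t + B * w n <= t2 &
      e * w n ^+ 2 <= `|flux u v s (s + A * w n) t (t + B * w n)|].
pose Sub (x y : nat * (R * R)) :=
  [/\ y.1 = x.1.+1, x.2.1 <= y.2.1, x.2.2 <= y.2.2,
      y.2.1 + A * w y.1 <= x.2.1 + A * w x.1 &
      y.2.2 + B * w y.1 <= x.2.2 + B * w x.1].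
(* One of the four quarters carries at least a quarter of the flux. *)
have step x : {y | Good x -> Good y /\ Sub x y}.
  apply: cid; case: (pselect (Good x)) => [|?]; last by exists x.
  case: x => n [s t] [S1 S2 T1 T2 E].
  have a0 : 0 <= A * w n.+1 by rewrite mulr_ge0 // ltW.
  have b0 : 0 <= B * w n.+1 by rewrite mulr_ge0 // ltW.
  have eA : A * w n = A * w n.+1 + A * w n.+1 by rewrite wS; ring.
  have eB : B * w n = B * w n.+1 + B * w n.+1 by rewrite wS; ring.
  have eE : e * w n ^+ 2 = 4 * (e * w n.+1 ^+ 2) by rewrite wS; ring.
  move: S2 T2 E; rewrite eA eB eE !addrA => S2 T2.
  set a := A * w n.+1 in a0 eA S2 *; set b := B * w n.+1 in b0 eB T2 *.
  rewrite (@flux_split _ u v s (s + a) (s + a + a) t (t + b) (t + b + b));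
    try lra; try by apply: cont_rectS cu _ _ _ _; lra.
    2: by apply: cont_rectS cv _ _ _ _; lra.
  set f1 := flux _ _ _ _ _ _; set f2 := flux _ _ _ _ _ _.
  set f3 := flux _ _ _ _ _ _; set f4 := flux _ _ _ _ _ _ => E.
  have : [\/ e * w n.+1 ^+ 2 <= `|f1|, e * w n.+1 ^+ 2 <= `|f2|,
             e * w n.+1 ^+ 2 <= `|f3| | e * w n.+1 ^+ 2 <= `|f4|].
    apply/or4P; apply/negPn/negP; rewrite !negb_or -!ltNge => /and4P[h1 h2 h3 h4].
    have := le_trans E (ler_normD _ _).
    have := ler_normD (f1 + f2) f3; have := ler_normD f1 f2; lra.
  case=> h; [exists (n.+1, (s, t)) | exists (n.+1, (s + a, t)) |
    exists (n.+1, (s, t + b)) | exists (n.+1, (s + a, t + b))] => _;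
    by (split; [split; rewrite -/a -/b //; lra |
                split; rewrite //= -/a -/b ?eA ?eB; lra]).
have [f [f0 fS]] := dependent_choice step (0, (s1, t1))%N.
have Gf n : Good (f n) /\ (f n).1 = n.
  elim: n => [|n [G e1]].
    rewrite f0; split=> //; split; rewrite ?/w ?expr0 ?mulr1 //; try (rewrite /A /B; lra).
    by rewrite expr1n mulr1 /A /B !(addrC _ (_ - _)) !subrK.
  by have [G' [-> _ _ _ _]] := fS _ G; rewrite e1.
have Sf n : Sub (f n) (f n.+1) by have [/fS[]] := Gf n.
pose S n := (f n).2.1; pose T n := (f n).2.2.
have mono n k : [/\ S n <= S (n + k)%N, T n <= T (n + k)%N,
    S (n + k)%N + A * w (n + k)%N <= S n + A * w n &
    T (n + k)%N + B * w (n + k)%N <= T n + B * w n].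
  elim: k => [|k [h1 h2 h3 h4]]; first by rewrite addn0.
  have [_ e1] := Gf (n + k)%N; have [_ e2] := Gf (n + k).+1.
  have := Sf (n + k)%N; rewrite /Sub e1 e2 addnS => -[_ k1 k2 k3 k4].
  by move: h1 h2 h3 h4 k1 k2 k3 k4; rewrite /S /T; split; lra.
have lim (X : nat -> R) (C : R) : 0 <= C ->
    (forall n k, X n <= X (n + k)%N /\ X (n + k)%N + C * w (n + k)%N <= X n + C * w n) ->
    exists x, forall n, X n <= x <= X n + C * w n.
  move=> C0 hX; have ub m n : X m <= X n + C * w n.
    have [h1 _] := hX m n; have [_ h2] := hX n m.
    rewrite addnC in h2; have := mulr_ge0 C0 (ltW (w0 (m + n)%N)); lra.
  exists (sup (range X)) => n; apply/andP; split.
    apply: sup_upper_bound; last by exists n.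
    by split; [exists (X 0%N), 0%N | exists (X 0%N + C * w 0%N) => _ [m _ <-]].
  apply: ge_sup; first by exists (X 0%N), 0%N.
  by move=> _ [m _ <-].
have [s hS] : exists s, forall n, S n <= s <= S n + A * w n.
  by apply: lim => // n k; have [] := mono n k.
have [t hT] : exists t, forall n, T n <= t <= T n + B * w n.
  by apply: lim => // n k; have [] := mono n k.
have [a [b [c [du dv]]]] : exists a b c,
     is_diff (s, t) u (fun w => a * w.1 + b * w.2) /\
     is_diff (s, t) v (fun w => c * w.1 + a * w.2).
  have w1 : w 0%N = 1 by rewrite /w expr0.
  have := hS 0%N; have := hT 0%N; rewrite /S /T f0 /= w1 /A /B => h1 h2.
  apply: hd; lra.
(* Small enough that 2 e' (A + B)^2 < e, which contradicts Good at stage n. *)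
pose e' := e / (4 * ((A + B) ^+ 2 + 1)).
have sq0 := sqr_ge0 (A + B).
have e'0 : 0 < e' by rewrite divr_gt0 //; lra.
have [d d0 hsm] := flux_small du dv e'0.
have [n hn] := half_pow_lt (A + B) d0; rewrite -/(w n) in hn.
have Aw := mulr_ge0 A0 (ltW (w0 n)); have Bw := mulr_ge0 B0 (ltW (w0 n)).
have [] := Gf n; have := hS n; have := hT n; rewrite /S /T.
case: (f n) => m [x y] /= hy hx [S1 S2 T1 T2 E] em; subst m.
have := hsm x (x + A * w n) y (y + B * w n) hx hy.
have -> : x + A * w n - x = A * w n by ring.
have -> : y + B * w n - y = B * w n by ring.
rewrite mulrDl in hn.
have -> : A * w n < d by lra.
have -> : B * w n < d by lra.
move=> /(_ isT isT).
have H1 : cont_rect u x (x + A * w n) y (y + B * w n).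
  by apply: cont_rectS cu _ _ _ _; lra.
have H2 : cont_rect v x (x + A * w n) y (y + B * w n).
  by apply: cont_rectS cv _ _ _ _; lra.
move=> /(_ H1 H2); apply/negP; rewrite -ltNge.
apply: lt_le_trans E; rewrite -mulrDl exprMn mulrA ltr_pM2r ?exprn_gt0 //.
have -> : 2 * e' * (A + B) ^+ 2 = e * ((A + B) ^+ 2 / (2 * ((A + B) ^+ 2 + 1))).
  by rewrite /e'; field; apply/eqP; lra.
rewrite -[ltRHS]mulr1 ltr_pM2l // ltr_pdivrMr; lra.
Qed.

End GoursatTheorem.

(** * Complex differentiability in real coordinates *)

Section ComplexDerivative.
Variable R : realType.
Implicit Types (phi psi : R * R -> R[i]) (z w : R * R) (c d : R[i]).

Definition toC z : R[i] := Complex z.1 z.2.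
Definition ofC c : R * R := (Re c, Im c).

Lemma toCK : cancel toC ofC. Proof. by case. Qed.

Lemma eqC (c d : R[i]) : Re c = Re d -> Im c = Im d -> c = d.
Proof. by case: c d => a b [a' b'] /= -> ->. Qed.

Lemma ReD c d : Re (c + d) = Re c + Re d. Proof. by case: c d => ? ? []. Qed.
Lemma ImD c d : Im (c + d) = Im c + Im d. Proof. by case: c d => ? ? []. Qed.
Lemma ReN c : Re (- c) = - Re c. Proof. by case: c. Qed.
Lemma ImN c : Im (- c) = - Im c. Proof. by case: c. Qed.
Lemma ReM c d : Re (c * d) = Re c * Re d - Im c * Im d.
Proof. by case: c d => ? ? []. Qed.
Lemma ImM c d : Im (c * d) = Re c * Im d + Im c * Re d.
Proof. by case: c d => ? ? []. Qed.
Lemma ReV c : Re c^-1 = Re c / (Re c ^+ 2 + Im c ^+ 2). Proof. by case: c. Qed.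
Lemma ImV c : Im c^-1 = - Im c / (Re c ^+ 2 + Im c ^+ 2).
Proof. by case: c => a b /=; rewrite mulNr. Qed.
Definition ReImE := (ReD, ImD, ReN, ImN, ReM, ImM).

Lemma is_diff_ext (V W : normedModType R) (f g df dg : V -> W) x :
  is_diff x f df -> f =1 g -> df =1 dg -> is_diff x g dg.
Proof. by move=> h /funext <- /funext <-. Qed.

Lemma is_diff_comp_derive (V : normedModType R) (f df : V -> R) (g : R -> R) x k :
  is_diff x f df -> is_derive (f x) 1 g k -> is_diff x (g \o f) (fun h => k * df h).
Proof.
move=> hf hg.
have dg : differentiable g (f x) by apply/derivable1_diffP; exact: ex_derive.
have dgE : is_diff (f x) g (fun h => k * h).
  split=> //; rewrite diff1E //; apply/funext => h.
  by rewrite derive1E derive_val /= mulrC.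
exact: is_diff_comp.
Qed.

(** Complex differentiability with derivative c: the real differential is
    multiplication by c. Splitting it into real and imaginary parts reduces the
    calculus rules to those for real-valued functions. *)
Definition cdiff phi z c :=
  is_diff z (fun x => Re (phi x)) (fun w => Re (c * toC w)) /\
  is_diff z (fun x => Im (phi x)) (fun w => Im (c * toC w)).

Lemma cdiff_ext phi psi z c d : cdiff phi z c -> phi =1 psi -> c = d ->
  cdiff psi z d.
Proof. by move=> h /funext <- <-. Qed.

Lemma cdiff_cst k z : cdiff (fun=> k) z 0.
Proof.
by split; (apply: is_diff_ext (is_diff_cst _ _) _ _ => // w; rewrite mul0r).
Qed.

Lemma is_diff_linear (V W : normedModType R) (f : V -> W) x :
  linear f -> continuous f -> is_diff x f f.
Proof.
move=> lf cf; pose fm := GRing.isLinear.Build _ _ _ _ f lf.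
pose fl : {linear V -> W} := HB.pack f fm.
by split; [exact: (@linear_differentiable _ _ _ fl) | exact: (@diff_lin _ _ _ fl)].
Qed.

Lemma cdiff_id z : cdiff toC z 1.
Proof.
split.
- apply: (@is_diff_ext _ _ fst _ fst) => // [|w]; last by rewrite mul1r.
  by apply: is_diff_linear => // p; exact: cvg_fst.
- apply: (@is_diff_ext _ _ snd _ snd) => // [|w]; last by rewrite mul1r.
  by apply: is_diff_linear => // p; exact: cvg_snd.
Qed.

Lemma cdiffD phi psi z c d : cdiff phi z c -> cdiff psi z d ->
  cdiff (fun x => phi x + psi x) z (c + d).
Proof.
move=> [p q] [p' q']; split.
- by apply: is_diff_ext (is_diffD p p') _ _ => x; rewrite !fctE /= ?mulrDl ReD.
- by apply: is_diff_ext (is_diffD q q') _ _ => x; rewrite !fctE /= ?mulrDl ImD.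
Qed.

Lemma cdiffM phi psi z c d : cdiff phi z c -> cdiff psi z d ->
  cdiff (fun x => phi x * psi x) z (c * psi z + phi z * d).
Proof.
move=> [p q] [p' q']; split.
- apply: is_diff_ext (is_diffB (is_diffM p p') (is_diffM q q')) _ _ => x;
    rewrite !fctE /= ?ReM // !ReImE /GRing.scale /=; ring.
- apply: is_diff_ext (is_diffD (is_diffM p q') (is_diffM q p')) _ _ => x;
    rewrite !fctE /= ?ImM // !ReImE /GRing.scale /=; ring.
Qed.

Lemma cdiff_comp phi psi z c d : cdiff phi (ofC (psi z)) c -> cdiff psi z d ->
  cdiff (fun x => phi (ofC (psi x))) z (c * d).
Proof.
move=> [p q] [p' q']; have pq := is_diff_pair p' q'; split.
- apply: is_diff_ext (is_diff_comp pq p) _ _ => x //=.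
  by rewrite !ReImE /=; ring.
- apply: is_diff_ext (is_diff_comp pq q) _ _ => x //=.
  by rewrite !ReImE /=; ring.
Qed.

Lemma cdiffV phi z c : cdiff phi z c -> phi z != 0 ->
  exists d, cdiff (fun x => (phi x)^-1) z d.
Proof.
move=> [p q] nz; exists (- c / phi z ^+ 2).
have nz2 : Re (phi z) ^+ 2 + Im (phi z) ^+ 2 != 0.
  apply: contra nz; rewrite paddr_eq0 ?sqr_ge0 // !sqrf_eq0.
  by case: (phi z) => a b /= /andP[/eqP-> /eqP->].
have aux (a b : R) : a ^+ 2 + b ^+ 2 != 0 ->
    (a * a - b * b) ^+ 2 + (a * b + b * a) ^+ 2 != 0.
  move=> h; suff -> : (a * a - b * b) ^+ 2 + (a * b + b * a) ^+ 2 =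
    (a ^+ 2 + b ^+ 2) ^+ 2 by rewrite expf_neq0.
  by ring.
have n : is_diff z (fun x => Re (phi x) ^+ 2 + Im (phi x) ^+ 2) _ :=
  is_diffD (is_diffM p p) (is_diffM q q).
have iv : is_derive (Re (phi z) ^+ 2 + Im (phi z) ^+ 2) 1 (fun x : R => x^-1)
    (- (Re (phi z) ^+ 2 + Im (phi z) ^+ 2) ^- 2 *: 1).
  exact: is_deriveV.
have ni := is_diff_comp_derive n iv.
split.
- apply: is_diff_ext (is_diffM p ni) _ _ => x.
    by rewrite !fctE /= ReV.
  rewrite !fctE /= /GRing.scale /= mulr1 !(ReImE, ReV, ImV).
  by field; apply/andP; split; [exact: aux nz2 | exact: nz2].
- apply: is_diff_ext (is_diffM (is_diffN q) ni) _ _ => x.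
    by rewrite !fctE /= ImV.
  rewrite !fctE /= /GRing.scale /= mulr1 !(ReImE, ReV, ImV).
  by field; apply/andP; split; [exact: aux nz2 | exact: nz2].
Qed.

Definition cexp (c : R[i]) : R[i] :=
  Complex (expR (Re c) * cos (Im c)) (expR (Re c) * sin (Im c)).

Lemma cexpD c d : cexp (c + d) = cexp c * cexp d.
Proof.
by apply: eqC; rewrite !ReImE /= !ReImE expRD ?cosD ?sinD; ring.
Qed.

Lemma cexp0 : cexp 0 = 1.
Proof. by apply: eqC; rewrite /= expR0 ?cos0 ?sin0 ?mulr1 ?mulr0. Qed.

Lemma cdiff_exp phi z c : cdiff phi z c ->
  cdiff (fun x => cexp (phi x)) z (cexp (phi z) * c).
Proof.
move=> [p q].
have e := is_diff_comp_derive p (is_derive_expR _).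
have co := is_diff_comp_derive q (is_derive_cos _).
have si := is_diff_comp_derive q (is_derive_sin _).
split.
- apply: is_diff_ext (is_diffM e co) _ _ => x;
    rewrite !fctE //= /GRing.scale /= !ReImE /=; ring.
- apply: is_diff_ext (is_diffM e si) _ _ => x;
    rewrite !fctE //= /GRing.scale /= !ReImE /=; ring.
Qed.

Lemma cdiff_continuous phi z c : cdiff phi z c ->
  {for z, continuous (fun x => Re (phi x))} /\
  {for z, continuous (fun x => Im (phi x))}.
Proof.
move=> [p q]; split.
  exact/differentiable_continuous/(@ex_diff _ _ _ _ _ _ _ p).
exact/differentiable_continuous/(@ex_diff _ _ _ _ _ _ _ q).
Qed.

End ComplexDerivative.

(** * Maximum modulus and local identity theorem *)

Section MaximumModulus.
Variable R : realType.
Implicit Types (phi : R * R -> R[i]) (z w a : R * R) (c k : R[i]).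

Definition sqdist z a : R := (z.1 - a.1) ^+ 2 + (z.2 - a.2) ^+ 2.

Lemma sqdist_ge0 z a : 0 <= sqdist z a.
Proof. by rewrite addr_ge0 ?sqr_ge0. Qed.

Lemma sqdistxx z : sqdist z z = 0.
Proof. by rewrite /sqdist !subrr expr0n addr0. Qed.

Lemma near_sqdist (P : R * R -> Prop) a :
  (\forall z \near a, P z) <-> exists2 e, 0 < e & forall z, sqdist z a < e -> P z.
Proof.
split.
  move=> /nbhs_ballP [e /= e0 he]; exists (e ^+ 2); first exact: exprn_gt0.
  move=> z hz; apply: he; have := sqr_ge0 (z.1 - a.1).
  have := sqr_ge0 (z.2 - a.2); move: hz; rewrite /sqdist => hz h1 h2.
  have aux (x y : R) : (x - y) ^+ 2 < e ^+ 2 -> `|y - x| < e.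
    by rewrite ltr_norml => h; apply/andP; split; nra.
  by split; apply: aux; lra.
move=> [e e0 he]; apply/nbhs_ballP.
pose d := Num.min 1 e / 2.
have [d0 d1 de] : [/\ 0 < d, d <= 1 / 2 & d <= e / 2].
  by rewrite /d; split; [by rewrite divr_gt0 // lt_min ltr01 | |];
     rewrite ler_pM2r ?invr_gt0 // ge_min lexx ?orbT.
exists d => // z [/= h1 h2]; apply: he.
move: h1 h2; rewrite /ball /= /sqdist !ltr_norml => /andP[h1 h2] /andP[h3 h4].
nra.
Qed.

Lemma near_sqdist_self a e : 0 < e -> \forall z \near a, sqdist z a < e.
Proof. by move=> e0; apply/near_sqdist; exists e. Qed.

Lemma sqdist_continuous a : continuous (fun z => sqdist z a).
Proof.
move=> z; rewrite /sqdist.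
have h1 : {for z, continuous (fun z : R * R => z.1 - a.1)}.
  by apply: cvgB; [exact: cvg_fst | exact: cvg_cst].
have h2 : {for z, continuous (fun z : R * R => z.2 - a.2)}.
  by apply: cvgB; [exact: cvg_snd | exact: cvg_cst].
exact: cvgD (cvgM h1 h1) (cvgM h2 h2).
Qed.

Lemma compact_disc a r : compact [set z | sqdist z a <= r].
Proof.
have [r0|r0] := ltP r 0.
  rewrite (_ : [set z | _] = set0); first exact: compact0.
  by apply/seteqP; split=> // z /=; have := sqdist_ge0 z a; lra.
pose m := 1 + r.
apply: (@subclosed_compact _ _
  (`[a.1 - m, a.1 + m]%classic `*` `[a.2 - m, a.2 + m]%classic)).
- apply: (@closed_comp _ _ (fun z => sqdist z a) [set x | x <= r]).
    by move=> z _; exact: sqdist_continuous.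
  exact: closed_le.
- by apply: compact_setX; exact: segment_compact.
- move=> [x y] /=; rewrite /sqdist /= /m !in_itv /= => h.
  have := sqr_ge0 (x - a.1); have := sqr_ge0 (y - a.2).
  by split; rewrite /=; apply/andP; split; nra.
Qed.

Lemma normc_ge0 c : 0 <= normc c.
Proof. by case: c => x y /=; exact: sqrtr_ge0. Qed.

Lemma sqr_normc c : normc c ^+ 2 = Re c ^+ 2 + Im c ^+ 2.
Proof. by case: c => x y /=; rewrite sqr_sqrtr // addr_ge0 ?sqr_ge0. Qed.

Lemma Re_le_normc c : Re c <= normc c.
Proof.
apply: le_trans (ler_norm _) _; rewrite -(@ler_pXn2r _ 2) ?nnegrE ?normc_ge0 //.
by rewrite real_normK ?num_real // sqr_normc lerDl sqr_ge0.
Qed.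

Lemma normcX c n : normc (c ^+ n) = normc c ^+ n.
Proof. by elim: n => [|n IH]; rewrite ?normc1 // !exprS normcM IH. Qed.

Lemma normc_toC z a : normc (toC z - toC a) = Num.sqrt (sqdist z a).
Proof. by []. Qed.

Lemma itv_expR_small (s2 e : R) : 0 < e -> exists2 s, s <= s2 & expR s ^+ 2 < e.
Proof.
move=> e0; pose m := Num.min 1 e / 2.
have [m0 m1 me] : [/\ 0 < m, m <= 1 / 2 & m <= e / 2].
  by rewrite /m; split; [by rewrite divr_gt0 // lt_min ltr01 | |];
     rewrite ler_pM2r ?invr_gt0 // ge_min lexx ?orbT.
exists (Num.min s2 (ln m)); first by rewrite ge_min lexx.
have h : expR (Num.min s2 (ln m)) <= m.
  by rewrite -[leRHS]lnK ?posrE // ler_expR ge_min lexx orbT.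
have := expR_gt0 (Num.min s2 (ln m)); nra.
Qed.

(** In the coordinates z = a + exp(s + i t) the Cauchy-Riemann equations and
    2 pi-periodicity in t make the integral of Re phi over a circle around a
    independent of s ([goursat]). Its mean tends to Re (phi a) as s goes to -oo, but
    would be at most Re (phi a) - e exp(2 s) on a fixed circle. *)
Lemma no_strict_max phi a r e : 0 < r -> 0 < e ->
  (forall z, sqdist z a < r -> exists c, cdiff phi z c) ->
  ~ (forall z, sqdist z a < r -> Re (phi z) <= Re (phi a) - e * sqdist z a).
Proof.
move=> r0 e0 dphi hmax.
pose pol w := ofC (toC a + cexp (toC w)).
have sqdist_pol w : sqdist (pol w) a = expR w.1 ^+ 2.
  rewrite /sqdist /= -[RHS]mulr1 -(cos2Dsin2 w.2); ring.
have [s2 _ hs2] := itv_expR_small 0 r0.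
pose m := expR s2 ^+ 2.
have m0 : 0 < m by rewrite exprn_gt0 // expR_gt0.
have em0 : 0 < e * m by rewrite mulr_gt0.
have [ca _] : {for a, continuous (fun x => Re (phi x))} /\
              {for a, continuous (fun x => Im (phi x))}.
  have [|c dc] := dphi a; first by rewrite sqdistxx.
  exact: cdiff_continuous dc.
have /near_sqdist[d d0 hd] : \forall z \near a, `|Re (phi a) - Re (phi z)| < e * m / 2.
  by apply: cvgr_dist_lt ca _ _; rewrite divr_gt0.
have [s1 s12 hs1] := itv_expR_small s2 d0.
pose u w := Re (phi (pol w)); pose v w := Im (phi (pol w)).
have dpol w : w.1 <= s2 -> exists c, cdiff (phi \o pol) w c.
  move=> ws; have [|c dc] := dphi (pol w).
    rewrite sqdist_pol; apply: le_lt_trans hs2; rewrite lerXn2r ?nnegrE ?expR_ge0 //.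
    by rewrite ler_expR.
  exists (c * (0 + cexp (toC w) * 1)).
  exact: (@cdiff_comp _ phi (fun w => toC a + cexp (toC w)) w _ _ dc
            (cdiffD (cdiff_cst _ _) (cdiff_exp (cdiff_id _)))).
have pi2 : 0 <= 2 * pi :> R by rewrite mulr_ge0 // pi_ge0.
have cu : cont_rect u s1 s2 0 (2 * pi).
  move=> s t hs ht; have [|c dc] := dpol (s, t); first by rewrite /=; lra.
  by have [] := cdiff_continuous dc.
have cv : cont_rect v s1 s2 0 (2 * pi).
  move=> s t hs ht; have [|c dc] := dpol (s, t); first by rewrite /=; lra.
  by have [] := cdiff_continuous dc.
have := @goursat _ u v s1 s2 0 (2 * pi) s12 pi2.
rewrite fluxE //.
(* The two horizontal sides carry the same values of v and cancel. *)
have -> : (fun s => v (s, 2 * pi)) = (fun s => v (s, 0)).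
  apply/funext => s; rewrite /v /pol /cexp /=.
  by rewrite mulr_natl cos2pi sin2pi cos0 sin0.
set V := segint (fun s => v (s, 0)) s1 s2; rewrite (subrr V) subr0 => hG.
have /hG/subr0_eq E : forall s t, s1 <= s <= s2 -> 0 <= t <= 2 * pi ->
    exists x y z : R, is_diff (s, t) u (fun w => x * w.1 + y * w.2) /\
                      is_diff (s, t) v (fun w => z * w.1 + x * w.2).
  move=> s t hs ht; have [|c [dr di]] := dpol (s, t); first by rewrite /=; lra.
  exists (Re c), (- Im c), (Im c); split.
  - by apply: is_diff_ext dr _ _ => // w; rewrite ReM /= mulNr.
  - by apply: is_diff_ext di _ _ => // w; rewrite ImM /= addrC.
have U2 : segint (fun t => u (s2, t)) 0 (2 * pi) <= (Re (phi a) - e * m) * (2 * pi - 0).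
  rewrite -(@segint_cst R (Re (phi a) - e * m) 0 (2 * pi)) //; apply: segint_le.
  - by apply: cont_slice1 cu _; rewrite s12 lexx.
  - by move=> x _; exact: cst_continuous.
  - by move=> t _; apply: le_trans (hmax _ _) _; rewrite sqdist_pol.
have U1 : (Re (phi a) - e * m / 2) * (2 * pi - 0) <= segint (fun t => u (s1, t)) 0 (2 * pi).
  rewrite -(@segint_cst R (Re (phi a) - e * m / 2) 0 (2 * pi)) //; apply: segint_le.
  - by move=> x _; exact: cst_continuous.
  - by apply: cont_slice1 cu _; rewrite lexx s12.
  - move=> t _; have := hd (pol (s1, t)); rewrite sqdist_pol => /(_ hs1).
    by move/(le_lt_trans (ler_norm _))/ltW; rewrite lerBlDr lerBlDl.
rewrite E in U2; have := le_trans U1 U2.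
rewrite subr0 ler_pM2r ?mulr_gt0 ?pi_gt0 // lerD2l lerN2; apply/negP.
by rewrite -ltNge ltr_pdivrMr // ltr_pMr // ltr1n.
Qed.

(** At a point z1 take k = conj (phi z1), so that Re (k phi z1) = |phi z1|^2. The
    function Re (k phi z) + e |z - a|^2 attains its maximum over the disc, and not in
    the interior: there the term e |z - a|^2 differs from e |z - zm|^2 by the real
    part of an affine holomorphic function, and [no_strict_max] applies. Letting e
    tend to 0 bounds |phi z1|^2 by |phi z1| M. *)
Theorem max_modulus phi a r (M : R) : 0 <= M ->
  (forall z, sqdist z a <= r -> exists c, cdiff phi z c) ->
  (forall z, sqdist z a = r -> normc (phi z) <= M) ->
  forall z, sqdist z a <= r -> normc (phi z) <= M.
Proof.
move=> M0 dphi bd z1 hz1; set K := [set z | sqdist z a <= r].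
have r0 : 0 <= r by apply: le_trans hz1; exact: sqdist_ge0.
pose k := conjc (phi z1).
have nk : normc k = normc (phi z1).
  by rewrite /k; case: (phi z1) => x y /=; rewrite sqrrN.
have kz1 : Re (k * phi z1) = normc (phi z1) ^+ 2.
  by rewrite sqr_normc ReM /k; case: (phi z1) => x y /=; ring.
have key e : 0 < e -> normc (phi z1) ^+ 2 <= normc (phi z1) * M + e * r.
  move=> e0; pose U z := Re (k * phi z) + e * sqdist z a.
  have cU z : K z -> {for z, continuous U}.
    move=> Kz; have [c dc] := dphi z Kz.
    have [h _] := cdiff_continuous (cdiffM (cdiff_cst k z) dc).
    apply: cvgD h _; apply: cvgM; [exact: cvg_cst | exact: sqdist_continuous].
  have [||zm zmK hm] := compact_EVT_max _ (@compact_disc a r) (f := U).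
  - by exists z1.
  - by apply: continuous_in_subspaceT => z; rewrite inE; exact: cU.
  rewrite inE /= in zmK.
  have Uz1 : U z1 <= U zm by apply: hm; rewrite inE.
  have [zb|zi] := eqVneq (sqdist zm a) r.
    have : Re (k * phi zm) <= normc (phi z1) * M.
      apply: le_trans (Re_le_normc _) _; rewrite normcM nk.
      by rewrite ler_wpM2l ?normc_ge0 // bd.
    have := mulr_ge0 (ltW e0) (sqdist_ge0 z1 a).
    move: Uz1; rewrite /U kz1 zb; lra.
  have zlt : sqdist zm a < r by rewrite lt_neqAle zi.
  have /near_sqdist[d d0 hd] : \forall z \near zm, sqdist z a < r.
    exact: (cvgr_lt _ (@sqdist_continuous a zm) _ zlt).
  (* Re (c0 z) is, up to a constant, the difference between e |z - a|^2 and
     e |z - zm|^2. *)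
  pose c0 := conjc (toC zm - toC a) * Complex (2 * e) 0.
  exfalso; apply: (@no_strict_max (fun z => k * phi z + c0 * toC z) zm d e d0 e0).
    move=> z /hd/ltW/dphi[c dc]; exists (0 * phi z + k * c + (0 * toC z + c0 * 1)).
    apply: cdiffD; apply: cdiffM => //; try exact: cdiff_cst.
    exact: cdiff_id.
  move=> z zd; have := hm z; rewrite inE /= => /(_ (ltW (hd _ zd))).
  rewrite /U /sqdist !(ReD, ReM (toC _)) /c0 !ReImE /=; lra.
rewrite leNgt; apply/negP => lt.
have p0 : 0 < normc (phi z1) ^+ 2 - normc (phi z1) * M by nra.
have := key ((normc (phi z1) ^+ 2 - normc (phi z1) * M) / (2 * (r + 1))).
have r1 : 0 < 2 * (r + 1) by lra.
rewrite divr_gt0 // => /(_ isT); set X := normc (phi z1) ^+ 2 - _ in p0 *.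
have : X / (2 * (r + 1)) * r < X.
  by rewrite mulrAC ltr_pdivrMr // ltr_pM2l //; lra.
rewrite /X; lra.
Qed.

Lemma is_diff_near_cst (V W : normedModType R) (f : V -> W) x (k : W) :
  (\forall y \near x, f y = k) -> is_diff x f 0.
Proof.
move=> hf; have fx : f x = k by exact: nbhs_singleton hf.
have c0 : continuous (\0 : {linear V -> W}) by move=> y; exact: cvg_cst.
have fo : f \o shift x = cst (f x) + (\0 : {linear V -> W}) +o_ 0 id.
  apply/eqaddoP => e e0; move: hf => /nbhs_normP [d /= d0 hd].
  apply/nbhs_normP; exists d => // y /=; rewrite sub0r normrN => yd.
  rewrite !fctE /= fx hd /=.
    by rewrite addr0 subrr normr0 mulr_ge0 // ltW.
  by rewrite opprD addrCA subrr addr0 normrN.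
have dE := diff_unique c0 fo.
split; last exact: dE.
by apply/diff_locallyP; rewrite dE.
Qed.

Lemma cdiff_near0 phi a : (\forall z \near a, phi z = 0) -> cdiff phi a 0.
Proof.
move=> h; split.
- have h' : \forall z \near a, Re (phi z) = 0 by near=> z; rewrite (near h z).
  by apply: is_diff_ext (is_diff_near_cst h') _ _ => // w; rewrite mul0r.
- have h' : \forall z \near a, Im (phi z) = 0 by near=> z; rewrite (near h z).
  by apply: is_diff_ext (is_diff_near_cst h') _ _ => // w; rewrite mul0r.
Unshelve. all: by end_near. Qed.

(** The quotients phi(z) / (z - a)^n extend by 0 to holomorphic functions on the
    disc. Bounding them on the circle of squared radius rho gives
    |phi z1| <= M (|z1 - a| / sqrt rho)^n for every n. *)
Theorem disc_identity phi a r :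
  (forall z, sqdist z a < r -> exists c, cdiff phi z c) ->
  (\forall z \near a, phi z = 0) ->
  forall z, sqdist z a < r -> phi z = 0.
Proof.
move=> dphi na z1 hz1.
have [->|z1a] := eqVneq z1 a; first exact: nbhs_singleton na.
have q0 : 0 < sqdist z1 a.
  rewrite lt_neqAle sqdist_ge0 andbT eq_sym; apply: contra z1a.
  rewrite /sqdist paddr_eq0 ?sqr_ge0 // !sqrf_eq0 !subr_eq0.
  by case: z1 a {hz1 na dphi} => x y [x' y'] /= /andP[/eqP-> /eqP->].
pose rho := (sqdist z1 a + r) / 2.
have [qr rr] : sqdist z1 a < rho /\ rho < r by rewrite /rho; lra.
have rho0 : 0 < rho by lra.
have [M M0 hM] : exists2 M, 0 <= M & forall z, sqdist z a <= rho -> normc (phi z) <= M.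
  pose U z := Re (phi z) * Re (phi z) + Im (phi z) * Im (phi z).
  have [||zm zmK hm] := compact_EVT_max _ (@compact_disc a rho) (f := U).
  - by exists z1; apply: ltW.
  - apply: continuous_in_subspaceT => z; rewrite inE /= => hz.
    have [|c dc] := dphi z; first exact: le_lt_trans rr.
    have [h h'] := cdiff_continuous dc.
    exact: cvgD (cvgM h h) (cvgM h' h').
  exists (normc (phi zm)); first exact: normc_ge0.
  move=> z hz; rewrite -(@ler_pXn2r _ 2) ?nnegrE ?normc_ge0 // !sqr_normc.
  by apply: hm; rewrite inE.
(* At z = a the inverse is 0 by convention; phi vanishes there anyway. *)
pose g n z := phi z * (toC z - toC a)^-1 ^+ n.
have dg n z : sqdist z a <= rho -> exists c, cdiff (g n) z c.
  move=> hz; have [->|za] := eqVneq z a.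
    exists 0; apply: cdiff_near0; near=> x; rewrite /g (near na x) ?mul0r //.
  have [|c dc] := dphi z; first exact: le_lt_trans rr.
  have nz : toC z - toC a != 0.
    rewrite subr_eq0; apply: contra za => /eqP h.
    by rewrite -(toCK z) h toCK.
  have [d dd] := cdiffV (cdiffD (cdiff_id z) (cdiff_cst (- toC a) z)) nz.
  elim: n => [|n [c' IH]].
    by exists c; apply: cdiff_ext dc _ _ => // x; rewrite /g expr0 mulr1.
  exists (c' * (toC z - toC a)^-1 + g n z * d).
  by apply: cdiff_ext (cdiffM IH dd) _ _ => // x; rewrite /g exprSr mulrA.
pose x := Num.sqrt (sqdist z1 a) / Num.sqrt rho.
have sq0 : 0 < Num.sqrt (sqdist z1 a) by rewrite sqrtr_gt0.
have sr0 : 0 < Num.sqrt rho by rewrite sqrtr_gt0.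
have bound n : normc (phi z1) <= M * x ^+ n.
  have B : normc (g n z1) <= M / Num.sqrt rho ^+ n.
    apply: (@max_modulus (g n) a rho); last exact: ltW.
    - by rewrite divr_ge0 // exprn_ge0 // ltW.
    - exact: dg.
    move=> z hz; rewrite /g normcM normcX normcV normc_toC hz exprVn.
    by rewrite ler_pM2r ?invr_gt0 ?exprn_gt0 // hM // hz.
  move: B; rewrite /g normcM normcX normcV normc_toC exprVn.
  rewrite ler_pdivrMr ?exprn_gt0 // => B; apply: le_trans B _.
  by rewrite /x expr_div_n mulrA mulrAC.
have x1 : `|x| < 1.
  by rewrite ger0_norm ?divr_ge0 ?sqrtr_ge0 // ltr_pdivrMr // mul1r ltr_sqrt.
apply: eq0_normc; apply/eqP; rewrite eq_le normc_ge0 andbT.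
have cv : (fun n => M * x ^+ n) @ \oo --> M * 0.
  by apply: cvgM; [exact: cvg_cst | exact: cvg_expr].
rewrite mulr0 in cv.
by apply: (cvgr_to_ge cv); apply: nearW => n; exact: bound.
Unshelve. all: by end_near. Qed.

End MaximumModulus.

(** * The complex exponential series *)

Section ExponentialSeries.
Variable R : realType.
Implicit Types (c d : R[i]) (u v : nat -> R[i]).

Definition ccvg u c :=
  (fun n => Re (u n)) @ \oo --> Re c /\ (fun n => Im (u n)) @ \oo --> Im c.

Lemma ccvgD u v c d : ccvg u c -> ccvg v d -> ccvg (fun n => u n + v n) (c + d).
Proof.
move=> [p q] [p' q']; split.
- rewrite ReD (_ : (fun n => _) = (fun n => Re (u n) + Re (v n))).
    exact: cvgD.
  by apply/funext => n; rewrite ReD.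
- rewrite ImD (_ : (fun n => _) = (fun n => Im (u n) + Im (v n))).
    exact: cvgD.
  by apply/funext => n; rewrite ImD.
Qed.

Lemma ccvgM k u c : ccvg u c -> ccvg (fun n => k * u n) (k * c).
Proof.
move=> [p q]; split.
- rewrite ReM (_ : (fun n => _) = (fun n => Re k * Re (u n) - Im k * Im (u n))).
    by apply: cvgB; apply: cvgM => //; exact: cvg_cst.
  by apply/funext => n; rewrite ReM.
- rewrite ImM (_ : (fun n => _) = (fun n => Re k * Im (u n) + Im k * Re (u n))).
    by apply: cvgD; apply: cvgM => //; exact: cvg_cst.
  by apply/funext => n; rewrite ImM.
Qed.

Definition csum u n : R[i] := \sum_(k < n) ((k`!%:R)^-1)%:C%C * u k.

Lemma csumD u v n : csum (fun k => u k + v k) n = csum u n + csum v n.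
Proof. by rewrite /csum -big_split /=; apply: eq_bigr => k _; rewrite mulrDr. Qed.

Lemma csumM k u n : csum (fun j => k * u j) n = k * csum u n.
Proof. by rewrite /csum mulr_sumr; apply: eq_bigr => j _; rewrite mulrCA. Qed.

Lemma Re_csum u n : Re (csum u n) = \sum_(k < n) (k`!%:R)^-1 * Re (u k).
Proof.
rewrite /csum (big_morph (@complex.Re R) (@ReD R) (erefl (Re 0))).
by apply: eq_bigr => k _; rewrite ReM /= mul0r subr0.
Qed.

Lemma Im_csum u n : Im (csum u n) = \sum_(k < n) (k`!%:R)^-1 * Im (u k).
Proof.
rewrite /csum (big_morph (@complex.Im R) (@ImD R) (erefl (Im 0))).
by apply: eq_bigr => k _; rewrite ImM /= mul0r addr0.
Qed.

Lemma is_derive_ext (f g : R -> R) (t d d' : R) : is_derive t 1 f d -> f =1 g ->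
  d = d' -> is_derive t 1 g d'.
Proof. by move=> h /funext <- <-. Qed.

Lemma is_derive_monomial n (t : R) :
  is_derive t 1 (fun s : R => s ^+ n.+1 / (n.+1)`!%:R) (t ^+ n / n`!%:R).
Proof.
have h := is_deriveZ (((n.+1)`!%:R)^-1) (is_deriveX n.+1 (is_derive_id t (1 : R))).
apply: is_derive_ext h _ _ => [s|].
  by rewrite !fctE /= mulrC.
have nz : n.+1%:R != 0 :> R by rewrite pnatr_eq0.
have fz : n`!%:R != 0 :> R by rewrite pnatr_eq0 -lt0n fact_gt0.
rewrite /GRing.scale /= mulr1 factS natrM.
by move: (n.+1%:R : R) (n`!%:R : R) nz fz => x y nx ny; field; rewrite nx ny.
Qed.

(** The induction step of Taylor's estimate: a bound on the derivative by a
    monomial integrates to a bound by the next one. *)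
Lemma integrate_bound (f df : R -> R) (C : R) n :
  f 0 = 0 -> (forall t : R, is_derive t 1 f (df t)) ->
  (forall t : R, 0 <= t -> t <= 1 -> `|df t| <= C * (t ^+ n / n`!%:R)) ->
  forall t : R, 0 <= t -> t <= 1 -> `|f t| <= C * (t ^+ n.+1 / (n.+1)`!%:R).
Proof.
move=> f0 hd bd t t0 t1.
have key (g dg : R -> R) : g 0 = 0 -> (forall t : R, is_derive t 1 g (dg t)) ->
    (forall t : R, 0 <= t -> t <= 1 -> dg t <= C * (t ^+ n / n`!%:R)) ->
    g t <= C * (t ^+ n.+1 / (n.+1)`!%:R).
  move=> g0 hg bg; pose h s := C * (s ^+ n.+1 / (n.+1)`!%:R) - g s.
  pose dh s := C * (s ^+ n / n`!%:R) - dg s.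
  have hh (s : R) : is_derive s 1 h (dh s).
    have e := is_deriveZ C (is_derive_monomial n s).
    exact: (is_deriveB e (hg s)).
  have [x xt] : exists2 x, x \in `[0, t]%R & h t - h 0 = dh x * (t - 0).
    apply: MVT_segment => // x.
    by apply: continuous_in_subspaceT => y _;
       exact/differentiable_continuous/derivable1_diffP/ex_derive.
  rewrite in_itv /= in xt; have /andP[x0 xt'] := xt.
  have : 0 <= dh x by rewrite subr_ge0 bg // (le_trans xt').
  rewrite /h g0 expr0n mul0r mulr0 subrr !subr0 => hx hE.
  by rewrite -subr_ge0 hE mulr_ge0.
rewrite ler_norml; apply/andP; split.
  rewrite lerNl; apply: (key (fun s => - f s) (fun s => - df s)).
  - by rewrite f0 oppr0.
  - by move=> s s0 /(bd _ s0); rewrite ler_norml => /andP[]; rewrite lerNl.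
by apply: (key f df) => // s s0 /(bd _ s0); rewrite ler_norml => /andP[].
Qed.

(** The remainders p n + i q n of the exponential series at t c satisfy
    R_(n+1)' = c R_n and R_(n+1)(0) = 0. As R_0 = e^(t c) is bounded, R_n is bounded
    by C (K t)^n / n! on [0, 1]. *)
Lemma cexp_series c : ccvg (csum (fun k => c ^+ k)) (cexp c).
Proof.
pose a := Re c; pose b := Im c.
pose p n t := expR (t * a) * cos (t * b) - \sum_(k < n) t ^+ k / k`!%:R * Re (c ^+ k).
pose q n t := expR (t * a) * sin (t * b) - \sum_(k < n) t ^+ k / k`!%:R * Im (c ^+ k).
have ml (k t : R) : is_derive t 1 (fun s => s * k) k.
  apply: is_derive_ext (is_deriveZ k (is_derive_id t (1 : R))) _ _ => [s|].
    exact: mulrC.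
  exact: mulr1.
have ea (t : R) : is_derive t 1 (fun s => expR (s * a)) (expR (t * a) * a).
  exact: (is_derive1_comp (is_derive_expR _) (ml a t)).
have cb (t : R) : is_derive t 1 (fun s => cos (s * b)) (- sin (t * b) * b).
  exact: (is_derive1_comp (is_derive_cos _) (ml b t)).
have sb (t : R) : is_derive t 1 (fun s => sin (s * b)) (cos (t * b) * b).
  exact: (is_derive1_comp (is_derive_sin _) (ml b t)).
have dsum (g : nat -> R) n (t : R) :
    is_derive t 1 (fun s => \sum_(k < n.+1) s ^+ k / k`!%:R * g k)
                  (\sum_(k < n) t ^+ k / k`!%:R * g k.+1).
  elim: n => [|n IH].
    apply: is_derive_ext (is_derive_cst (g 0%N) t (1 : R)) _ _ => [s|].
      by rewrite big_ord1 expr0 divr1 mul1r.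
    by rewrite big_ord0.
  have h := is_deriveD IH (is_deriveZ (g n.+1) (is_derive_monomial n t)).
  apply: is_derive_ext h _ _ => [s|].
    by rewrite !fctE /= [RHS]big_ord_recr /= [g _ *: _]mulrC.
  by rewrite [RHS]big_ord_recr /= [g _ *: _]mulrC.
have dp n (t : R) : is_derive t 1 (p n.+1) (a * p n t - b * q n t).
  have h := is_deriveB (is_deriveM (ea t) (cb t)) (dsum (fun k => Re (c ^+ k)) n t).
  apply: is_derive_ext h _ _ => [s|]; first by rewrite !fctE.
  rewrite /p /q !mulrBr !mulr_sumr /GRing.scale /=.
  under [X in _ - X = _]eq_bigr => k _.
    rewrite exprS ReM -/a -/b mulrBr !(mulrCA (_ / _)); over.
  rewrite sumrB; ring.
have dq n (t : R) : is_derive t 1 (q n.+1) (a * q n t + b * p n t).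
  have h := is_deriveB (is_deriveM (ea t) (sb t)) (dsum (fun k => Im (c ^+ k)) n t).
  apply: is_derive_ext h _ _ => [s|]; first by rewrite !fctE.
  rewrite /p /q !mulrBr !mulr_sumr /GRing.scale /=.
  under [X in _ - X = _]eq_bigr => k _.
    rewrite exprS ImM -/a -/b mulrDr !(mulrCA (_ / _)); over.
  rewrite big_split /=; ring.
have at0 (g : nat -> R) n : \sum_(k < n.+1) 0 ^+ k / k`!%:R * g k = g 0%N.
  rewrite big_ord_recl expr0 divr1 mul1r big1 ?addr0 // => k _.
  by rewrite expr0n /= mul0r mul0r.
have p0 n : p n.+1 0 = 0.
  rewrite /p; move: (at0 (fun k => Re (c ^+ k)) n) => /= ->.
  by rewrite !mul0r expR0 cos0 mulr1 subrr.
have q0 n : q n.+1 0 = 0.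
  rewrite /q; move: (at0 (fun k => Im (c ^+ k)) n) => /= ->.
  by rewrite !mul0r expR0 sin0 mulr0 subrr.
pose K := `|a| + `|b|; pose C := expR `|a|.
have K0 : 0 <= K by rewrite addr_ge0.
have split_bd n (x : R) : C * K ^+ n.+1 * x =
    `|a| * (C * K ^+ n * x) + `|b| * (C * K ^+ n * x).
  by rewrite exprS /K -/K; set y := K ^+ n; rewrite /K; ring.
have bd n t : 0 <= t -> t <= 1 -> `|p n t| <= C * K ^+ n * (t ^+ n / n`!%:R) /\
                     `|q n t| <= C * K ^+ n * (t ^+ n / n`!%:R).
  elim: n t => [|n IH] t t0 t1.
    rewrite /p /q !big_ord0 !subr0 !expr0 divr1 !mulr1 !normrM.
    have h : `|expR (t * a)| <= C.
      rewrite ger0_norm ?expR_ge0 // ler_expR; apply: le_trans (ler_norm _) _.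
      by rewrite normrM ger0_norm // ler_piMl.
    split; rewrite -[leRHS]mulr1; apply: ler_pM => //.
      by rewrite ler_norml cos_geN1 cos_le1.
    by rewrite ler_norml sin_geN1 sin_le1.
  split.
    apply: (@integrate_bound (p n.+1) (fun s => a * p n s - b * q n s) (C * K ^+ n.+1) n) => //.
    move=> s s0 s1; have [h1 h2] := IH s s0 s1.
    apply: le_trans (ler_normB _ _) _; rewrite !normrM.
    by rewrite split_bd; apply: lerD; rewrite ler_wpM2l.
  apply: (@integrate_bound (q n.+1) (fun s => a * q n s + b * p n s) (C * K ^+ n.+1) n) => //.
  move=> s s0 s1; have [h1 h2] := IH s s0 s1.
  apply: le_trans (ler_normD _ _) _; rewrite !normrM.
  by rewrite split_bd; apply: lerD; rewrite ler_wpM2l.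
have lim0 : (fun n => C * K ^+ n * (1 ^+ n / n`!%:R)) @ \oo --> (0 : R).
  rewrite (_ : (fun n => _) = (fun n => C * exp_coeff K n)).
    rewrite -[X in _ --> X](mulr0 C); apply: cvgM; first exact: cvg_cst.
    exact: cvg_series_cvg_0 (is_cvg_series_exp_coeff K).
  by apply/funext => n; rewrite expr1n mul1r /exp_coeff /= mulrA.
have conv (u : nat -> R) (l : R) :
    (forall n, `|l - u n| <= C * K ^+ n * (1 ^+ n / n`!%:R)) -> u @ \oo --> l.
  move=> h; apply/cvgrPdist_le => e e0; near=> n.
  apply: le_trans (h n) _; apply: le_trans (ler_norm _) _; rewrite -normrN -sub0r.
  by near: n; apply: cvgr_dist_le lim0 _ e0.
split; apply: conv => n; have [h1 h2] := bd n 1 ler01 (lexx _).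
- move: h1; rewrite /p !mul1r Re_csum; congr (`|_ - _| <= _).
  by apply: eq_bigr => k _; rewrite expr1n mul1r.
- move: h2; rewrite /q !mul1r Im_csum; congr (`|_ - _| <= _).
  by apply: eq_bigr => k _; rewrite expr1n mul1r.
Unshelve. all: by end_near. Qed.

End ExponentialSeries.

(** * Exponential of a scalar plus a vector *)

Section ExponentialCoefficients.
Variable R : realType.
Implicit Types (a N m c d : R[i]).

(** The coefficients A_n and B_n of (a + v)^n = A_n + B_n v, where v * v = - N. *)
Definition pow_coef a N n : R[i] * R[i] :=
  iter n (fun p => (a * p.1 - N * p.2, p.1 + a * p.2)) (1, 0).

Lemma pow_coef_neq0 a m n : m != 0 ->
  pow_coef a (- m ^+ 2) n = (2^-1 * ((a + m) ^+ n + (a - m) ^+ n),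
                             (2 * m)^-1 * ((a + m) ^+ n - (a - m) ^+ n)).
Proof.
move=> m0; have two0 : 2 != 0 :> R[i] by rewrite pnatr_eq0.
elim: n => [|n IH].
  by rewrite /pow_coef /= !expr0 subrr mulr0 -mulr2n -[_ *+ 2]mulr_natl mulr1 mulVf.
rewrite /pow_coef iterS -/(pow_coef _ _ _) IH /= !exprS; congr pair;
  by field; rewrite ?m0 ?two0.
Qed.

Lemma pow_coef_0 a n : pow_coef a 0 n = (a ^+ n, n%:R * a ^+ n.-1).
Proof.
elim: n => [|n IH]; first by rewrite mul0r.
rewrite /pow_coef iterS -/(pow_coef _ _ _) IH /= mul0r subr0 exprS; congr pair.
case: n {IH} => [|n] /=; first by rewrite !expr0 mul0r mulr0 mul1r addr0.
by rewrite mulrCA -exprS -[n.+2]add1n natrD mulrDl mul1r.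
Qed.

Lemma half_double c : 2^-1 * (c + c) = c.
Proof. by rewrite -mulr2n -[c *+ 2]mulr_natl mulKf // pnatr_eq0. Qed.

Definition exp_coefA a m := 2^-1 * (cexp (a + m) + cexp (a - m)).
(** The entire function e^a sinh m / m, with its limit value at m = 0. *)
Definition exp_coefB a m :=
  if m == 0 then cexp a else (2 * m)^-1 * (cexp (a + m) - cexp (a - m)).

Lemma csum_ext u v n : u =1 v -> csum u n = csum v n :> R[i].
Proof. by move=> /funext ->. Qed.

Lemma ccvg_ext (u v : nat -> R[i]) c : ccvg u c -> u =1 v -> ccvg v c.
Proof. by move=> h /funext <-. Qed.

Lemma ccvg_lin (k x y : R[i]) :
  ccvg (csum (fun n => k * (x ^+ n + y ^+ n))) (k * (cexp x + cexp y)).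
Proof.
apply: (@ccvg_ext (fun n => k * (csum (fun j => x ^+ j) n + csum (fun j => y ^+ j) n))).
  by apply: ccvgM; apply: ccvgD; exact: cexp_series.
by move=> n; rewrite -csumD -csumM.
Qed.

(** The numbers a + m and a - m are the eigenvalues of multiplication by a + v. If
    they differ, the coefficients of the powers are combinations of their powers;
    if m = 0, the coefficient of v is n a^(n-1), whose exponential series is
    that of e^a shifted by one. *)
Lemma exp_coefP a N m : m ^+ 2 = - N ->
  ccvg (csum (fun n => (pow_coef a N n).1)) (exp_coefA a m) /\
  ccvg (csum (fun n => (pow_coef a N n).2)) (exp_coefB a m).
Proof.
move=> hm; have -> : N = - m ^+ 2 by rewrite hm opprK.
have ext (u v : nat -> R[i]) c : ccvg (csum u) c -> u =1 v -> ccvg (csum v) c.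
  by move=> h /funext <-.
have [->|m0] := eqVneq m 0.
  rewrite expr0n oppr0; split.
    apply: (ext (fun n => a ^+ n)); last by move=> n; rewrite pow_coef_0.
    rewrite /exp_coefA addr0 subr0 half_double.
    exact: cexp_series.
  rewrite /exp_coefB eqxx.
  apply: (ext (fun n => n%:R * a ^+ n.-1)); last by move=> n; rewrite pow_coef_0.
  have e n : csum (fun j => j%:R * a ^+ j.-1) n.+1 = csum (fun j => a ^+ j) n.
    rewrite /csum big_ord_recl mul0r mulr0 add0r; apply: eq_bigr => j _.
    rewrite !lift0 /= mulrA; congr (_ * _).
    have nz : j.+1%:R != 0 :> R by rewrite pnatr_eq0.
    have fz : j`!%:R != 0 :> R by rewrite pnatr_eq0 -lt0n fact_gt0.
    rewrite factS natrM -(rmorph_nat (real_complex R)) -rmorphM; congr (_%:C)%C.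
    by move: (j.+1%:R : R) (j`!%:R : R) nz fz => x y nx ny; field; rewrite nx ny.
  have [p q] := cexp_series a; split.
    by rewrite -(cvg_shiftS) /=; under eq_fun do rewrite e.
  by rewrite -(cvg_shiftS) /=; under eq_fun do rewrite e.
split.
  apply: ext (ccvg_lin 2^-1 (a + m) (a - m)) _ => n.
  by rewrite pow_coef_neq0.
rewrite /exp_coefB (negbTE m0).
apply: (@ccvg_ext (fun n => (2 * m)^-1 * (csum (fun j => (a + m) ^+ j) n +
                              (-1) * csum (fun j => (a - m) ^+ j) n))).
  rewrite -[- cexp (a - m)]mulN1r.
  by apply: ccvgM; apply: ccvgD; [|apply: ccvgM]; exact: cexp_series.
move=> n; rewrite -csumM -csumD -csumM; apply: csum_ext => k.
by rewrite pow_coef_neq0 // mulN1r.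
Qed.

Lemma cexp_neq0 c : cexp c != 0.
Proof.
apply/eqP => /(congr1 (fun x => x * cexp (- c))).
rewrite -cexpD subrr cexp0 mul0r => /eqP; by rewrite oner_eq0.
Qed.

Lemma sin_int_pi (n : int) : sin (n%:~R * pi) = 0 :> R.
Proof.
have h k : sin (k%:R * pi) = 0 :> R.
  by elim: k => [|k IH]; rewrite ?mul0r ?sin0 // mulrSr mulrDl mul1r sinDpi IH oppr0.
case: n => n; first exact: h.
by rewrite NegzE mulrNz mulNr sinN h oppr0.
Qed.

Lemma sin_eq0_int (x : R) : sin x = 0 -> exists n : int, x = n%:~R * pi.
Proof.
move=> sx; have p0 := pi_gt0 R; pose n := Num.floor (x / pi).
exists n; pose y := x - n%:~R * pi.
have /andP[h1 h2] : n%:~R <= x / pi < (n + 1)%:~R by exact: floor_itv.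
rewrite ler_pdivlMr // in h1; rewrite ltr_pdivrMr // intrD mulrDl mul1r in h2.
have y0 : 0 <= y by rewrite subr_ge0.
have y1 : y < pi by rewrite ltrBlDl.
have sy : sin y = 0 by rewrite sinB sx sin_int_pi mulr0 mul0r subrr.
apply/eqP; rewrite -subr_eq0 -/y eq_le y0 andbT leNgt; apply/negP => yp.
by have := @sin_gt0_pi R y; rewrite yp y1 sy ltxx => /(_ isT).
Qed.

(** B = 0 means e^m = e^(-m). The moduli give Re m = 0, and then sin (Im m) = 0. *)
Lemma exp_coefB_eq0 a m : exp_coefB a m = 0 ->
  exists2 n : int, n != 0 & m = Complex 0 (n%:~R * pi).
Proof.
rewrite /exp_coefB; have [_|m0] := eqVneq m 0.
  by move/eqP; rewrite (negbTE (cexp_neq0 a)).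
move/eqP; rewrite mulf_eq0 invr_eq0 mulf_eq0 pnatr_eq0 (negbTE m0) /=.
rewrite !cexpD -mulrBr mulf_eq0 (negbTE (cexp_neq0 a)) subr_eq0 /= => /eqP.
case: m m0 => p q m0; rewrite /cexp /= => -[E1 E2].
have ep := expR_gt0 p; have en := expR_gt0 (- p).
have sq : sin q = 0.
  have : sin q * (expR p + expR (- p)) = 0.
    by rewrite mulrDr mulrC E2 sinN mulrN mulrC addNr.
  by move/eqP; rewrite mulf_eq0 => /orP[/eqP //|]; rewrite gt_eqF // addr_gt0.
have cq : cos q != 0.
  by apply/eqP => cq; have := sin0cos1 sq; rewrite cq normr0 => /eqP; rewrite eq_sym oner_eq0.
have p0 : p = 0.
  rewrite cosN in E1; have /expR_inj := mulIf cq E1; lra.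
have [n qE] := sin_eq0_int sq; exists n; last by rewrite p0 qE.
by apply: contra m0 => /eqP n0; rewrite p0 qE n0 mul0r.
Qed.

Lemma exp_coef_int_pi a (n : int) : n != 0 ->
  exp_coefA a (Complex 0 (n%:~R * pi)) = cexp a * (cos (n%:~R * pi))%:C%C /\
  exp_coefB a (Complex 0 (n%:~R * pi)) = 0.
Proof.
move=> n0; set m := Complex _ _.
have e1 : cexp m = (cos (n%:~R * pi))%:C%C.
  by apply: eqC; rewrite /= expR0 mul1r // sin_int_pi.
have e2 : cexp (- m) = (cos (n%:~R * pi))%:C%C.
  by apply: eqC; rewrite /= oppr0 expR0 mul1r ?cosN // sinN sin_int_pi oppr0.
split.
  by rewrite /exp_coefA !cexpD e1 e2 half_double.
rewrite /exp_coefB; case: eqP => [m0|_]; last by rewrite !cexpD e1 e2 subrr mulr0.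
case: m0 => /eqP; rewrite mulf_eq0 (gt_eqF (pi_gt0 R)) orbF intr_eq0.
by rewrite (negbTE n0).
Qed.

End ExponentialCoefficients.

(** * The slice exponential in complex coordinates *)

Section SliceExponential.
Variable R : realType.
Local Notation CC := (R * R)%type.
Local Notation HC := (quat R * quat R)%type.
Implicit Types (D : set CC) (F G : CC -> HC) (f g : quat R -> quat R) (w : HC).
Implicit Types (a b c d : R[i]) (z : CC).

(** The complexified quaternion with complex coordinates a, b, c, d with respect to
    1, i, j, k. In these coordinates the product is the quaternion product over
    the complex numbers. *)
Definition biq a b c d : HC :=
  (Quat (Re a) (Re b) (Re c) (Re d), Quat (Im a) (Im b) (Im c) (Im d)).
Definition biq_a w : R[i] := Complex (qa w.1) (qa w.2).
Definition biq_b w : R[i] := Complex (qb w.1) (qb w.2).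
Definition biq_c w : R[i] := Complex (qc w.1) (qc w.2).
Definition biq_d w : R[i] := Complex (qd w.1) (qd w.2).
(** The stem function of the symmetrization of the vector part. *)
Definition vnorm w : R[i] := biq_b w ^+ 2 + biq_c w ^+ 2 + biq_d w ^+ 2.

Lemma biqK w : biq (biq_a w) (biq_b w) (biq_c w) (biq_d w) = w.
Proof. by case: w => [[? ? ? ?] [? ? ? ?]]. Qed.

Lemma biq_aE a b c d : biq_a (biq a b c d) = a. Proof. by case: a. Qed.
Lemma biq_bE a b c d : biq_b (biq a b c d) = b. Proof. by case: b. Qed.
Lemma biq_cE a b c d : biq_c (biq a b c d) = c. Proof. by case: c. Qed.
Lemma biq_dE a b c d : biq_d (biq a b c d) = d. Proof. by case: d. Qed.
Definition biqE := (biq_aE, biq_bE, biq_cE, biq_dE).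

Lemma biq_inj a b c d a' b' c' d' : biq a b c d = biq a' b' c' d' ->
  [/\ a = a', b = b', c = c' & d = d'].
Proof.
move=> h; split; [have := congr1 biq_a h | have := congr1 biq_b h |
  have := congr1 biq_c h | have := congr1 biq_d h]; by rewrite !biqE.
Qed.

Lemma conjHC_biq a b c d :
  conjHC (biq a b c d) = biq (conjc a) (conjc b) (conjc c) (conjc d).
Proof. by case: a b c d => ? ? [? ?] [? ?] [? ?]. Qed.

Lemma mulIHC_biq a b c d : mulIHC (biq a b c d) =
  biq ('i%C * a) ('i%C * b) ('i%C * c) ('i%C * d).
Proof.
case: a b c d => ? ? [? ?] [? ?] [? ?].
by congr pair; apply: quat_eq; rewrite /= ?mul0r ?mul1r ?addr0 ?add0r ?sub0r.
Qed.

Lemma mulHC_biq a b c d A B :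
  mulHC (biq a b c d) (biq A (B * b) (B * c) (B * d)) =
  biq (a * A - (b ^+ 2 + c ^+ 2 + d ^+ 2) * B)
     ((A + a * B) * b) ((A + a * B) * c) ((A + a * B) * d).
Proof.
case: a b c d A B => ? ? [? ?] [? ?] [? ?] [? ?] [? ?].
by congr pair; apply: quat_eq; rewrite /=; ring.
Qed.

Lemma mulHC_conj w w' : mulHC (conjHC w) (conjHC w') = conjHC (mulHC w w').
Proof. by rewrite /mulHC /conjHC /= !mulrNN mulrN mulNr -opprD. Qed.

Lemma stem_ofE D F f z : stem D F -> induces D F f -> D z -> stem_of D f z = F z.
Proof.
move=> sF iF Dz.
have [_ iS] : [set F | stem D F /\ induces D F f] (stem_of D f).
  by apply: (@xgetPex _ (fun=> (0, 0)) [set F | stem D F /\ induces D F f]); exists F.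
exact: stem_unique iS iF _ Dz.
Qed.

Lemma slice_eq_induces D F G : conj_invariant D -> stem D F ->
  (forall z, D z -> G z = F z) -> induces D F (slice G).
Proof.
move=> cD sF GF x y I Dz II.
have sG : stem D G by move=> z Dz'; rewrite !GF //; [exact: sF | exact: cD].
by rewrite (slice_induces sG) // GF.
Qed.

Lemma stem_mul D F G : stem D F -> stem D G -> stem D (fun z => mulHC (F z) (G z)).
Proof. by move=> sF sG z Dz; rewrite sF // sG // mulHC_conj. Qed.

Lemma smul_induces D F G f g : conj_invariant D ->
  stem D F -> induces D F f -> stem D G -> induces D G g ->
  induces D (fun z => mulHC (F z) (G z)) (smul D f g).
Proof.
move=> cD sF iF sG iG; apply: slice_eq_induces => //; first exact: stem_mul.
by move=> z Dz; rewrite (stem_ofE sF iF) // (stem_ofE sG iG).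
Qed.

Definition pow_stem F n z : HC :=
  let p := pow_coef (biq_a (F z)) (vnorm (F z)) n in
  biq p.1 (p.2 * biq_b (F z)) (p.2 * biq_c (F z)) (p.2 * biq_d (F z)).

Lemma pow_stemS F n z : pow_stem F n.+1 z = mulHC (F z) (pow_stem F n z).
Proof.
set p := pow_coef (biq_a (F z)) (vnorm (F z)) n.
have := mulHC_biq (biq_a (F z)) (biq_b (F z)) (biq_c (F z)) (biq_d (F z)) p.1 p.2.
by rewrite biqK => ->.
Qed.

Lemma spow_induces D F f n : conj_invariant D -> stem D F -> induces D F f ->
  stem D (pow_stem F n) /\ induces D (pow_stem F n) (spow D f n).
Proof.
move=> cD sF iF.
have e0 z : pow_stem F 0 z = (1, 0).
  by congr pair; apply: quat_eq; rewrite /= ?mul0r ?subr0 ?addr0.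
have eS k : pow_stem F k.+1 = (fun z => mulHC (F z) (pow_stem F k z)).
  by apply/funext => z; exact: pow_stemS.
elim: n => [|n [IHs IHi]].
  split; first by move=> z _; rewrite !e0 /conjHC /= oppr0.
  by move=> x y I _ _; rewrite e0 /= mulr0 addr0.
rewrite eS; split; first exact: stem_mul.
exact: smul_induces.
Qed.

Definition exp_stem F (m : CC -> R[i]) z : HC :=
  let A := exp_coefA (biq_a (F z)) (m z) in
  let B := exp_coefB (biq_a (F z)) (m z) in
  biq A (B * biq_b (F z)) (B * biq_c (F z)) (B * biq_d (F z)).

(** With the vector part fixed, the value of A + B v depends real-linearly on A
    and B: convergence of a series of such values reduces to four real series. *)
Lemma biq_eval (A B b c d : R[i]) (I : quat R) :
  (biq A (B * b) (B * c) (B * d)).1 + I * (biq A (B * b) (B * c) (B * d)).2 =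
  Re A *: 1 + Im A *: I +
  Re B *: ((biq 0 b c d).1 + I * (biq 0 b c d).2) +
  Im B *: (- (biq 0 b c d).2 + I * (biq 0 b c d).1).
Proof.
case: A B b c d I => ? ? [? ?] [? ?] [? ?] [? ?] [? ? ? ?].
by apply: quat_eq; rewrite /=; ring.
Qed.

(** Any square root m of - vnorm may be chosen, independently at each point. *)
Lemma sexp_induces D F f (m : CC -> R[i]) : conj_invariant D ->
  stem D F -> induces D F f -> (forall z, D z -> m z ^+ 2 = - vnorm (F z)) ->
  induces D (exp_stem F m) (sexp D f).
Proof.
move=> cD sF iF hm x y I Dz II; set z := (x, y).
have [[rA iA] [rB iB]] := exp_coefP (biq_a (F z)) (hm _ Dz).
rewrite /exp_stem biq_eval; apply/cvg_lim => //.
set V1 := _ + I * _; set V2 := - _ + I * _.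
pose p n := pow_coef (biq_a (F z)) (vnorm (F z)) n.
have sE : series (fun n => (n`!%:R)^-1 *: spow D f n (x%:A + y *: I)) =
   (fun n => Re (csum (fun k => (p k).1) n) *: 1 + Im (csum (fun k => (p k).1) n) *: I +
             Re (csum (fun k => (p k).2) n) *: V1 + Im (csum (fun k => (p k).2) n) *: V2).
  apply/funext => n; rewrite /series /= big_mkord !Re_csum !Im_csum.
  rewrite !scaler_suml -!big_split /=; apply: eq_bigr => k _.
  have [_ ->//] := spow_induces k cD sF iF.
  by rewrite /pow_stem biq_eval !scalerDr !scalerA.
rewrite sE; apply: cvgD; [apply: cvgD; [apply: cvgD|]|];
  by apply: cvgZ => //; exact: cvg_cst.
Qed.

Definition vec_stem F z : HC := biq 0 (biq_b (F z)) (biq_c (F z)) (biq_d (F z)).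

Lemma stem_coordP D F : stem D F <-> (forall z, D z ->
  [/\ biq_a (F (conjC2 z)) = conjc (biq_a (F z)), biq_b (F (conjC2 z)) = conjc (biq_b (F z)),
      biq_c (F (conjC2 z)) = conjc (biq_c (F z)) & biq_d (F (conjC2 z)) = conjc (biq_d (F z))]).
Proof.
split=> [sF z Dz|h z Dz].
  have := conjHC_biq (biq_a (F z)) (biq_b (F z)) (biq_c (F z)) (biq_d (F z)).
  by rewrite biqK (sF _ Dz) => ->; rewrite !biqE.
by have [h1 h2 h3 h4] := h z Dz; rewrite -(biqK (F z)) conjHC_biq -h1 -h2 -h3 -h4 biqK.
Qed.

Lemma vec_stem_stem D F : stem D F -> stem D (vec_stem F).
Proof.
move=> /stem_coordP sF; apply/stem_coordP => z Dz; have [_ h2 h3 h4] := sF z Dz.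
by rewrite !biqE h2 h3 h4 conjc0.
Qed.

Lemma sconj_induces D F f : conj_invariant D -> stem D F -> induces D F f ->
  induces D (fun z => (conjq (F z).1, conjq (F z).2)) (sconj D f).
Proof.
move=> cD sF iF; apply: slice_eq_induces => //.
  move=> z Dz; rewrite (sF _ Dz) /conjHC /=; congr pair.
by move=> z Dz; rewrite (stem_ofE sF iF).
Qed.

Lemma sconj_stem D F : stem D F -> stem D (fun z => (conjq (F z).1, conjq (F z).2)).
Proof.
move=> sF z Dz; rewrite (sF _ Dz) /conjHC /=; congr pair.
Qed.

Lemma svec_induces D F f : conj_invariant D -> stem D F -> induces D F f ->
  induces D (vec_stem F) (svec D f).
Proof.
move=> cD sF iF x y I Dz II; rewrite /svec (iF x y I) //.
rewrite (@sconj_induces D F f cD sF iF x y I) // /vec_stem.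
case: (F _) => [[? ? ? ?] [? ? ? ?]]; case: I II => ? ? ? ? _.
by apply: quat_eq; rewrite /=; field.
Qed.

Lemma ssym_svec_induces D F f : conj_invariant D -> stem D F -> induces D F f ->
  induces D (fun z => biq (vnorm (F z)) 0 0 0) (ssym D (svec D f)).
Proof.
move=> cD sF iF.
have sv := vec_stem_stem sF; have iv := svec_induces cD sF iF.
have := smul_induces cD sv iv (sconj_stem sv) (sconj_induces cD sv iv).
congr induces; apply/funext => z; rewrite /vec_stem /vnorm.
case: (F z) => [[? ? ? ?] [? ? ? ?]]; congr pair.
  by apply: quat_eq; rewrite /=; ring.
by apply: quat_eq; rewrite /=; ring.
Qed.

Lemma induces_cstP D g (k : quat R) : induces D (fun=> (k, 0)) g <->
  (forall q, circularization D q -> g q = k).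
Proof.
split=> [h q [x [y [I [Dz II ->]]]]|h x y I Dz II].
  by rewrite (h x y I) //= mulr0 addr0.
by rewrite /= mulr0 addr0; apply: h; exists x, y, I.
Qed.

End SliceExponential.

(** * Holomorphic stem functions by coordinates *)

Section HolomorphicCoordinates.
Variable R : realType.
Local Notation CC := (R * R)%type.
Local Notation HC := (quat R * quat R)%type.
Implicit Types (D : set CC) (F : CC -> HC) (z : CC).

Lemma quat_coord_continuous (l : quat R -> R) :
  (forall (k : R) p q, l (k *: p + q) = k * l p + l q) ->
  (forall q, `|l q| <= Defs.normq q) -> continuous l.
Proof.
move=> ll lb q; apply/(@cvgrPdist_lt _ _ _ _ (nbhs_filter q)) => e e0.
apply/nbhs_normP; exists e => // p /= qp.
have lB : l q - l p = l (q - p).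
  have := ll (-1) p q; rewrite !scaleN1r addrC => ->.
  by rewrite addrC mulN1r.
rewrite lB; exact: le_lt_trans (lb _) qp.
Qed.

Lemma quat_coord_le (q : quat R) : [/\ `|qa q| <= Defs.normq q, `|qb q| <= Defs.normq q,
  `|qc q| <= Defs.normq q & `|qd q| <= Defs.normq q].
Proof.
have h (x : R) : x ^+ 2 <= sqnormq q -> `|x| <= Defs.normq q.
  by move=> hx; rewrite -sqrtr_sqr ler_wsqrtr.
have := sqr_ge0 (qa q); have := sqr_ge0 (qb q); have := sqr_ge0 (qc q).
have := sqr_ge0 (qd q); rewrite /sqnormq in h *.
by split; apply: h; lra.
Qed.

(** Complex linearity of the differential T of F, evaluated at 1 and at the
    imaginary unit, determines it by its value at 1. *)
Lemma holomorphic_coord F z (l : quat R -> R) :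
  (forall (k : R) p q, l (k *: p + q) = k * l p + l q) -> continuous l ->
  differentiable F z -> (forall v, 'd F z (mulI v) = mulIHC ('d F z v)) ->
  exists c, cdiff (fun x => Complex (l (F x).1) (l (F x).2)) z c.
Proof.
move=> ll lc dF hol; have iF := differentiableP dF.
have l1 : is_diff (F z) (fun w : HC => l w.1) (fun w => l w.1).
  apply: is_diff_linear; first by move=> k [? ?] [? ?]; exact: ll.
  move=> w; apply: (@continuous_comp _ _ _ (fst : HC -> quat R) l); last exact: lc.
  exact: cvg_fst.
have l2 : is_diff (F z) (fun w : HC => l w.2) (fun w => l w.2).
  apply: is_diff_linear; first by move=> k [? ?] [? ?]; exact: ll.
  move=> w; apply: (@continuous_comp _ _ _ (snd : HC -> quat R) l); last exact: lc.
  exact: cvg_snd.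
pose e : CC := (1, 0); pose T := 'd F z e.
have TE (w : CC) : 'd F z w = w.1 *: T + w.2 *: mulIHC T.
  rewrite -hol -!linearZ -linearD; congr ('d F z _).
  rewrite [RHS](_ : _ = (w.1 * 1 + w.2 * - 0, w.1 * 0 + w.2 * 1)) //.
  by rewrite oppr0 !mulr0 !mulr1 addr0 add0r; case: w.
have lN q : l (- q) = - l q.
  have := ll (-1) q 0; have := ll (-1) 0 0; rewrite !addr0 scaler0.
  rewrite !scaleN1r => h1 ->; lra.
have lZD x y p q : l (x *: p + y *: q) = x * l p + y * l q.
  have l0 : l 0 = 0 by have := lN 0; rewrite oppr0; lra.
  by rewrite ll; have := ll y q 0; rewrite !addr0 l0 addr0 => ->.
exists (Complex (l T.1) (l T.2)); split.
- apply: is_diff_ext (is_diff_comp iF l1) _ _ => // w.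
  by rewrite /= TE /= lZD lN; ring.
- apply: is_diff_ext (is_diff_comp iF l2) _ _ => // w.
  by rewrite /= TE /= lZD; ring.
Qed.

Lemma holomorphic_coords D F z : holomorphic D F -> D z ->
  [/\ exists c, cdiff (fun x => biq_a (F x)) z c, exists c, cdiff (fun x => biq_b (F x)) z c,
      exists c, cdiff (fun x => biq_c (F x)) z c & exists c, cdiff (fun x => biq_d (F x)) z c].
Proof.
move=> hol Dz; have [dF dFI] := hol _ Dz.
have lb q := quat_coord_le q.
by split; apply: holomorphic_coord => //; apply: quat_coord_continuous => // q;
  have [] := lb q.
Qed.

Lemma holomorphic_biq D (a b c d : CC -> R[i]) :
  (forall z, D z -> [/\ exists k, cdiff a z k, exists k, cdiff b z k,
      exists k, cdiff c z k & exists k, cdiff d z k]) ->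
  holomorphic D (fun z => biq (a z) (b z) (c z) (d z)).
Proof.
move=> h z Dz; have [[ka [ra ia]] [kb [rb ib]] [kc [rc ic]] [kd [rd id]]] := h z Dz.
pose e0 : quat R := Quat 1 0 0 0; pose e1 : quat R := Quat 0 1 0 0.
pose e2 : quat R := Quat 0 0 1 0; pose e3 : quat R := Quat 0 0 0 1.
have Z (p dp : CC -> R) (e : quat R) : is_diff z p dp ->
    is_diff z (fun x => p x *: e) (fun w => dp w *: e).
  by move=> hp; exact: (is_diff_comp hp (is_diff_scalel (p z) e)).
have Q (p0 p1 p2 p3 d0 d1 d2 d3 : CC -> R) : is_diff z p0 d0 -> is_diff z p1 d1 ->
    is_diff z p2 d2 -> is_diff z p3 d3 ->
    is_diff z (fun x => Quat (p0 x) (p1 x) (p2 x) (p3 x))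
              (fun w => Quat (d0 w) (d1 w) (d2 w) (d3 w)).
  move=> h0 h1 h2 h3.
  have := is_diffD (is_diffD (is_diffD (Z _ _ e0 h0) (Z _ _ e1 h1)) (Z _ _ e2 h2)) (Z _ _ e3 h3).
  by move=> /is_diff_ext; apply=> x; apply: quat_eq; rewrite /=; ring.
have H := is_diff_pair (Q _ _ _ _ _ _ _ _ ra rb rc rd) (Q _ _ _ _ _ _ _ _ ia ib ic id).
have HF : is_diff z (fun z => biq (a z) (b z) (c z) (d z))
  (fun w => biq (ka * toC w) (kb * toC w) (kc * toC w) (kd * toC w)).
  exact: H.
split; first exact: (@ex_diff _ _ _ _ _ _ _ HF).
move=> v; rewrite (@diff_val _ _ _ _ _ _ _ HF) mulIHC_biq.
have -> : toC (mulI v) = 'i%C * toC v.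
  by case: v => x y; rewrite /toC /mulI; apply: eqC; rewrite !ReImE /=; ring.
by rewrite !(mulrCA 'i%C).
Qed.

End HolomorphicCoordinates.

(** * Connectedness of circular domains and global identity *)

Section CircularTopology.
Variable R : realType.
Local Notation CC := (R * R)%type.
Implicit Types (D : set CC) (z : CC) (P : CC -> Prop).

Definition qi : quat R := Quat 0 1 0 0.

Lemma qi_unit : imag_units qi.
Proof. by apply: quat_eq; rewrite /=; ring. Qed.

Definition section_i z : quat R := (z.1)%:A + z.2 *: qi.
Definition half_plane (q : quat R) : CC := (qa q, `|imq q|).

Lemma half_planeE (x y : R) (I : quat R) : imag_units I ->
  half_plane (x%:A + y *: I) = (x, `|y|).
Proof.
move=> /imag_unitsP [I0 nI].
have ex : qa (x%:A + y *: I) = x by rewrite /= I0 !mulr0 mulr1 addr0.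
have ei : imq (x%:A + y *: I) = y *: I by rewrite /imq ex addrC addKr.
by rewrite /half_plane ei ex normrZ [`|I|]nI mulr1.
Qed.

Lemma norm_in D (x y : R) : conj_invariant D -> D (x, `|y|) <-> D (x, y).
Proof.
move=> cD; have [y0|y0] := ler0P y; last by [].
split=> h; first by rewrite -[y]opprK; exact: (cD _ h).
exact: (cD _ h).
Qed.

Lemma circ_half_plane D q : conj_invariant D -> circularization D q -> D (half_plane q).
Proof.
by move=> cD [x [y [I [Dz II ->]]]]; rewrite half_planeE //; apply/norm_in.
Qed.

Lemma circ_section D z : circularization D (section_i z) -> conj_invariant D -> D z.
Proof.
move=> h cD; have := circ_half_plane cD h.
rewrite half_planeE; last exact: qi_unit.
by case: z h => x y _ /norm_in; apply.
Qed.

Lemma section_circ D z : D z -> circularization D (section_i z).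
Proof. by case: z => x y h; exists x, y, qi; split=> //; exact: qi_unit. Qed.

Lemma section_continuous : continuous section_i.
Proof.
move=> z; apply: cvgD; (apply: cvgZ; last exact: cvg_cst).
  exact: cvg_fst.
exact: cvg_snd.
Qed.

Lemma half_plane_continuous : continuous half_plane.
Proof.
have ca : continuous (fun q : quat R => qa q).
  apply: quat_coord_continuous => // q; by have [] := quat_coord_le q.
move=> q; apply: (@cvg_pair _ _ _ (nbhs q) (nbhs (qa q)) (nbhs `|imq q|)).
  exact: ca.
apply: cvg_norm; apply: cvgB; first exact: cvg_id.
by apply: cvgZ; [exact: ca | exact: cvg_cst].
Qed.

Lemma circ_open D : conj_invariant D -> open (circularization D) ->
  forall z, D z -> \forall x \near z, D x.
Proof.
move=> cD oO z Dz.
have h : \forall q \near section_i z, circularization D q.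
  by apply: open_nbhs_nbhs; split=> //; exact: section_circ.
have := @section_continuous z _ h; rewrite /= nbhs_simpl /=.
by apply: filterS => x /= hx; exact: circ_section hx cD.
Qed.

(** The map q |-> (Re q, |Im q|) sends the circular set into D, and each point of D is
    in its image up to conjugation. A locally constant, conjugation-invariant
    property of points of D thus pulls back to a set that is open and closed in
    the connected circular set; D itself may have two components. *)
Lemma circ_locally_constant D P : conj_invariant D ->
  open (circularization D) -> connected (circularization D) ->
  (forall z, D z -> P z -> P (conjC2 z)) ->
  (forall z, D z -> \forall x \near z, P x <-> P z) ->
  forall z0, D z0 -> P z0 -> forall z, D z -> P z.
Proof.
move=> cD oO conn Pconj loc z0 Dz0 Pz0 z Dz.
pose O := circularization D.
have Pabs (x y : R) : D (x, y) -> P (x, y) <-> P (x, `|y|).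
  move=> Dxy; have [y0|y0] := ler0P y; last by [].
  split=> [|h]; first exact: (Pconj (x, y)).
  rewrite -[y]opprK; apply: (Pconj (x, - y)) => //.
  exact: (cD _ Dxy).
have openC (Q : CC -> Prop) : (forall z, D z -> \forall x \near z, Q x <-> Q z) ->
    open [set q | O q /\ Q (half_plane q)].
  move=> Qloc; rewrite openE => q [Oq Qq]; rewrite /interior.
  have h1 : \forall q' \near q, O q' by apply: open_nbhs_nbhs; split.
  have h2 := @half_plane_continuous q _ (Qloc _ (circ_half_plane cD Oq)).
  rewrite /= nbhs_simpl /= in h2.
  by near=> q'; split; [near: q' | apply/(near h2 q')].
have BE : [set q | O q /\ P (half_plane q)] = O.
  apply: conn.
  - exists (section_i z0); split; first exact: section_circ.
    rewrite half_planeE; last exact: qi_unit.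
    by apply/(Pabs z0.1 z0.2); rewrite -surjective_pairing.
  - exists [set q | O q /\ P (half_plane q)]; first exact: openC.
    by apply/seteqP; split=> q /=; [move=> [? ?] | move=> [_ []]].
  - exists (~` [set q | O q /\ ~ P (half_plane q)]).
      apply: open_closedC; apply: (openC (fun x => ~ P x)) => x Dx.
      by apply: filterS (loc x Dx) => w [h1 h2]; split=> h h'; apply: h; auto.
    apply/seteqP; split=> q /=; first by move=> [Oq Pq]; split=> // -[].
    by move=> [Oq h]; split=> //; apply: contrapT => nP; apply: h.
have : O (section_i z) by exact: section_circ.
rewrite -BE => -[_]; rewrite half_planeE; last exact: qi_unit.
by move=> /(Pabs z.1 z.2); rewrite -surjective_pairing; apply.
Unshelve. all: by end_near. Qed.

End CircularTopology.

Section IdentityTheorem.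
Variable R : realType.
Local Notation CC := (R * R)%type.
Implicit Types (D : set CC) (z : CC) (phi : CC -> R[i]).

(** Two values differing by less than the gap h coincide. *)
Lemma discrete_locally_constant phi z (h : R) : 0 < h ->
  (exists c, cdiff phi z c) ->
  (\forall x \near z, exists n : int, phi x = (n%:~R * h)%:C%C) ->
  \forall x \near z, phi x = phi z.
Proof.
move=> h0 [c dc] hn; have [cr _] := cdiff_continuous dc.
have [n0 e0] := nbhs_singleton hn.
have cl : \forall x \near z, `|Re (phi z) - Re (phi x)| < h.
  by apply: cvgr_dist_lt cr _ _.
near=> x; have [n e] : exists n : int, phi x = (n%:~R * h)%:C%C by near: x.
have : `|Re (phi z) - Re (phi x)| < h by near: x.
rewrite e0 e /= -mulrBl -intrB normrM (gtr0_norm h0) gtr_pMl // -intr_norm.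
by rewrite ltrz1 -[X in _ < X]add0r ltzD1 normr_le0 subr_eq0 => /eqP ->.
Unshelve. all: by end_near. Qed.

Lemma sqdist_sym (z w : CC) : sqdist z w = sqdist w z.
Proof. by rewrite /sqdist; ring. Qed.

Lemma sqdist_triangle (x y z : CC) : sqdist x z <= 2 * sqdist x y + 2 * sqdist y z.
Proof.
rewrite /sqdist; have := sqr_ge0 (x.1 - y.1 - (y.1 - z.1)).
have := sqr_ge0 (x.2 - y.2 - (y.2 - z.2)); nra.
Qed.

(** By [disc_identity], being equal to k on a neighbourhood is a locally constant
    property; it is invariant under conjugation because k is real. *)
Theorem circ_identity D phi (k : R) : conj_invariant D ->
  open (circularization D) -> connected (circularization D) ->
  (forall z, D z -> exists c, cdiff phi z c) ->
  (forall z, D z -> phi (conjC2 z) = conjc (phi z)) ->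
  forall z0, D z0 -> (\forall x \near z0, phi x = k%:C%C) ->
  forall z, D z -> phi z = k%:C%C.
Proof.
move=> cD oO conn dphi cphi z0 Dz0 h0 z Dz.
pose P z := \forall x \near z, phi x = k%:C%C.
suff : P z by exact: nbhs_singleton.
apply: (@circ_locally_constant R D P cD oO conn _ _ z0) => //.
- move=> x Dx /near_sqdist [e e0 he]; rewrite /P.
  have hD := circ_open cD oO (cD _ Dx); near=> w.
  have Dw : D w by near: w.
  have := cphi _ (cD _ Dw).
  rewrite /conjC2 /= opprK -surjective_pairing => ->.
  rewrite [phi _]he; first exact: conjc_real.
  have : sqdist w (conjC2 x) < e by near: w; exact: near_sqdist_self.
  rewrite /sqdist /= opprK => hw.
  by rewrite (_ : (- w.2 - x.2) ^+ 2 = (w.2 + x.2) ^+ 2) //; ring.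
move=> x Dx; have [r r0 hr] := (near_sqdist _ _).1 (circ_open cD oO Dx).
have [Px|nPx] := pselect (P x).
  by apply: filterS (nbhs_interior Px) => w Pw; split.
near=> w; split=> // Pw; exfalso; apply: nPx.
have wx : sqdist w x < r / 4 by near: w; apply: near_sqdist_self; rewrite divr_gt0.
have zero y : sqdist y w < r / 4 -> phi y + - k%:C%C = 0.
  apply: (@disc_identity R (fun y => phi y + - k%:C%C) w (r / 4)).
    move=> v hv; have [|c dc] := dphi v.
      by apply: hr; have := sqdist_triangle v w x; lra.
    by exists (c + 0); apply: cdiffD => //; exact: cdiff_cst.
  by apply: filterS Pw => v ->; rewrite subrr.
have : \forall y \near x, sqdist y w < r / 4.
  by apply: (cvgr_lt _ (@sqdist_continuous _ w x)); rewrite sqdist_sym.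
by apply: filterS => y /zero/subr0_eq.
Unshelve. all: by end_near. Qed.

End IdentityTheorem.

(** * Slice exponentials preserving the reals or a complex slice *)

Section ConjugationRules.
Variable R : realType.
Implicit Types c d : R[i].

Lemma conjcD c d : conjc (c + d) = conjc c + conjc d. Proof. exact: rmorphD. Qed.
Lemma conjcM c d : conjc (c * d) = conjc c * conjc d. Proof. exact: rmorphM. Qed.
Lemma conjcN c : conjc (- c) = - conjc c. Proof. exact: rmorphN. Qed.
Lemma conjcX c n : conjc (c ^+ n) = conjc c ^+ n. Proof. exact: rmorphXn. Qed.
Lemma conjci : conjc 'i%C = - 'i%C :> R[i].
Proof. by apply: eqC; rewrite /= ?oppr0. Qed.

Lemma cexp_conj c : cexp (conjc c) = conjc (cexp c).
Proof. by case: c => x y; rewrite /cexp /= cosN sinN mulrN. Qed.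

End ConjugationRules.

Section SliceExponentialReal.
Variable R : realType.
Local Notation CC := (R * R)%type.
Local Notation HC := (quat R * quat R)%type.
Variables (D : set CC) (F : CC -> HC) (f : quat R -> quat R).
Hypotheses (cD : conj_invariant D) (oD : open (circularization D))
  (connD : connected (circularization D)).
Hypotheses (sF : stem D F) (hF : holomorphic D F) (iF : induces D F f).
Implicit Types (z : CC) (J : quat R).

Lemma vnorm_cdiff z : D z -> exists c, cdiff (fun x => vnorm (F x)) z c.
Proof.
move=> Dz; have [_ [b hb] [c hc] [d hd]] := holomorphic_coords hF Dz.
by eexists; exact: cdiffD (cdiffD (cdiffM hb hb) (cdiffM hc hc)) (cdiffM hd hd).
Qed.

Lemma vnorm_conj z : D z -> vnorm (F (conjC2 z)) = conjc (vnorm (F z)).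
Proof.
move=> Dz; have [_ h2 h3 h4] := (stem_coordP D F).1 sF z Dz.
by rewrite /vnorm h2 h3 h4 !conjcD !conjcX.
Qed.

Lemma exp_coefB_vnorm z m : m ^+ 2 = - vnorm (F z) ->
  exp_coefB (biq_a (F z)) m = 0 ->
  exists2 n : int, n != 0 & vnorm (F z) = (n%:~R ^+ 2 * pi ^+ 2)%:C%C.
Proof.
move=> hm /exp_coefB_eq0 [n n0 mE]; exists n => //.
by apply: oppr_inj; rewrite -hm mE; apply: eqC; rewrite expr2 ReImE /=; ring.
Qed.

Lemma SR_real_cexp (k : R) :
  induces D (fun z => biq (cexp (biq_a (F z)) * k%:C%C) 0 0 0) (sexp D f) ->
  SR_real D (sexp D f).
Proof.
move=> iE; exists (fun z => biq (cexp (biq_a (F z)) * k%:C%C) 0 0 0); split.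
- apply/stem_coordP => z Dz; rewrite !biqE conjc0; split=> //.
  have [h _ _ _] := (stem_coordP D F).1 sF z Dz.
  by rewrite h cexp_conj conjcM conjc_real.
- apply: holomorphic_biq => z Dz; have [[c hc] _ _ _] := holomorphic_coords hF Dz.
  by split; eexists; [exact: cdiffM (cdiff_exp hc) (cdiff_cst _ _) | exact: cdiff_cst..].
- exact: iE.
- by move=> z Dz; split; eexists; apply: quat_eq; rewrite /= ?mulr1 ?mulr0.
Qed.

Lemma SR_real_of_vec0 : (forall z, D z -> vec_stem F z = 0) -> SR_real D (sexp D f).
Proof.
move=> h; have hv z : D z -> [/\ biq_b (F z) = 0, biq_c (F z) = 0 & biq_d (F z) = 0].
  by move=> /h; rewrite (_ : 0 = biq 0 0 0 0) // => /biq_inj[].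
apply: (@SR_real_cexp 1).
have hm z : D z -> (fun=> 0) z ^+ 2 = - vnorm (F z).
  by move=> /hv [h2 h3 h4]; rewrite /vnorm h2 h3 h4 !expr0n !addr0 oppr0.
move=> x y I Dz II; rewrite (sexp_induces cD sF iF hm Dz II) /exp_stem.
have [-> -> ->] := hv _ Dz.
by rewrite /exp_coefA addr0 subr0 half_double !mulr0 mulr1.
Qed.

(** Here m = i n pi is constant, B vanishes and A = e^a cos (n pi). *)
Lemma SR_real_of_vnorm (n : int) : n != 0 ->
  (forall z, D z -> vnorm (F z) = (n%:~R ^+ 2 * pi ^+ 2)%:C%C) ->
  SR_real D (sexp D f).
Proof.
move=> n0 h; pose m : R[i] := Complex 0 (n%:~R * pi).
apply: (@SR_real_cexp (cos (n%:~R * pi))).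
have hm z : D z -> (fun=> m) z ^+ 2 = - vnorm (F z).
  by move=> /h ->; apply: eqC; rewrite expr2 ReImE /=; ring.
move=> x y I Dz II; rewrite (sexp_induces cD sF iF hm Dz II) /exp_stem.
have [hA hB] := exp_coef_int_pi (biq_a (F (x, y))) n0.
by rewrite hA hB !mul0r.
Qed.

Let m z := sqrtc (- vnorm (F z)).

Lemma sqrt_vnorm z : m z ^+ 2 = - vnorm (F z).
Proof. exact: sqr_sqrtc. Qed.

Lemma sexp_stem : induces D (exp_stem F m) (sexp D f).
Proof. by apply: sexp_induces => // z _; exact: sqrt_vnorm. Qed.

Lemma real_dichotomy z : D z -> SR_real D (sexp D f) ->
  vec_stem F z = 0 \/
  exists2 n : int, n != 0 & vnorm (F z) = (n%:~R ^+ 2 * pi ^+ 2)%:C%C.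
Proof.
move=> Dz [G [_ _ iG rG]]; have [[x1 e1] [x2 e2]] := rG z Dz.
have E := stem_unique sexp_stem iG Dz.
have : G z = biq (Complex x1 x2) 0 0 0.
  rewrite [G z]surjective_pairing e1 e2.
  by congr pair; apply: quat_eq; rewrite /= ?mulr1 ?mulr0.
rewrite -E => /biq_inj [_ h2 h3 h4].
have [B0|B0] := eqVneq (exp_coefB (biq_a (F z)) (m z)) 0.
  by right; exact: exp_coefB_vnorm (sqrt_vnorm z) B0.
left; have cancelB c : exp_coefB (biq_a (F z)) (m z) * c = 0 -> c = 0.
  by move/eqP; rewrite mulf_eq0 (negbTE B0) => /eqP.
by rewrite /vec_stem (cancelB _ h2) (cancelB _ h3) (cancelB _ h4).
Qed.

Lemma vnorm_vec0 z : vec_stem F z = 0 -> vnorm (F z) = 0.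
Proof.
rewrite (_ : 0 = biq 0 0 0 0) // => /biq_inj[_ h2 h3 h4].
by rewrite /vnorm h2 h3 h4 !expr0n !addr0.
Qed.

(** At each point vnorm is n^2 pi^2 for an integer n, including n = 0 where the
    vector part vanishes, so it is constant. The value decides between the cases:
    if it is 0, no point can have n <> 0. *)
Lemma real_const z0 : D z0 -> SR_real D (sexp D f) ->
  (forall z, D z -> vec_stem F z = 0) \/
  exists2 n : int, n != 0 &
    forall z, D z -> vnorm (F z) = (n%:~R ^+ 2 * pi ^+ 2)%:C%C.
Proof.
move=> Dz0 hr.
have val z : D z -> exists n : int, vnorm (F z) = (n%:~R * pi ^+ 2)%:C%C.
  move=> Dz; have [/vnorm_vec0 ->|[n _ ->]] := real_dichotomy Dz hr.
    by exists 0; rewrite mul0r.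
  by exists (n ^+ 2); rewrite rmorphXn.
have cst : forall z, D z -> vnorm (F z) = vnorm (F z0).
  apply: (@circ_locally_constant R D (fun z => vnorm (F z) = vnorm (F z0))
    cD oD connD _ _ z0) => //.
  - move=> x Dx h; rewrite vnorm_conj // h; have [n ->] := val _ Dz0.
    exact: conjc_real.
  - move=> x Dx.
    have : \forall y \near x, vnorm (F y) = vnorm (F x).
      apply: (@discrete_locally_constant R (fun y => vnorm (F y)) x (pi ^+ 2)).
      + by rewrite exprn_gt0 // pi_gt0.
      + exact: vnorm_cdiff.
      + by apply: filterS (circ_open cD oD Dx) => y /val.
    by apply: filterS => y ->.
have [v0|[n n0 hn]] := real_dichotomy Dz0 hr; last first.
  by right; exists n => // z Dz; rewrite cst.
left=> z Dz; have [//|[n n0 hn]] := real_dichotomy Dz hr.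
move: hn; rewrite cst // vnorm_vec0 // => /(congr1 (@complex.Re R)) /= /esym/eqP.
by rewrite mulf_eq0 !expf_eq0 /= intr_eq0 (negbTE n0) (gt_eqF (pi_gt0 R)).
Qed.

Variable J : quat R.
Hypothesis unitJ : imag_units J.

(** The component of the vector part along J for the complex bilinear extension of
    the scalar product. *)
Definition Jcomp (w : HC) : R[i] :=
  biq_b w * (qb J)%:C%C + biq_c w * (qc J)%:C%C + biq_d w * (qd J)%:C%C.

Lemma J_coords : qa J = 0 /\ qb J ^+ 2 + qc J ^+ 2 + qd J ^+ 2 = 1.
Proof.
have [J0 nJ] := imag_unitsP unitJ; split=> //.
have := sqr_sqrtr (sqnormq_ge0 J); rewrite -/(Defs.normq J) nJ expr1n /sqnormq J0 => ->.
by rewrite expr0n add0r.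
Qed.

Lemma CplaneP (w : HC) : Cplane J w.1 /\ Cplane J w.2 <->
  [/\ biq_b w = Jcomp w * (qb J)%:C%C, biq_c w = Jcomp w * (qc J)%:C%C &
      biq_d w = Jcomp w * (qd J)%:C%C].
Proof.
have [J0 J1] := J_coords; split.
  case: w => w1 w2 /= [[x [y ->]] [x' [y' ->]]].
  have -> : Jcomp (x%:A + y *: J, x'%:A + y' *: J) = Complex y y'.
    apply: eqC; rewrite /Jcomp !ReImE /=.
      transitivity (y * (qb J ^+ 2 + qc J ^+ 2 + qd J ^+ 2)); first ring.
      by rewrite J1 mulr1.
    transitivity (y' * (qb J ^+ 2 + qc J ^+ 2 + qd J ^+ 2)); first ring.
    by rewrite J1 mulr1.
  by split; apply: eqC; rewrite ReImE /=; ring.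
move=> [e2 e3 e4].
have reE (s t : R[i]) (k : R) : s = t * k%:C%C -> Re s = Re t * k /\ Im s = Im t * k.
  by move=> ->; rewrite ReM ImM /= !mulr0 subr0 add0r.
move: (reE _ _ _ e2) (reE _ _ _ e3) (reE _ _ _ e4).
move: (Re (Jcomp w)) (Im (Jcomp w)) => t t' [/= b1 b2] [/= c1 c2] [/= d1 d2].
split; [exists (qa w.1), t | exists (qa w.2), t']; apply: quat_eq;
  by rewrite /= ?b1 ?b2 ?c1 ?c2 ?d1 ?d2 ?J0; ring.
Qed.

Lemma biq_Cplane (A S : R[i]) :
  let w := biq A (S * (qb J)%:C%C) (S * (qc J)%:C%C) (S * (qd J)%:C%C) in
  Cplane J w.1 /\ Cplane J w.2.
Proof.
have [J0 _] := J_coords; case: A S => x x' [y y'] /=; split; [exists x, y | exists x', y'];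
  by apply: quat_eq; rewrite /= ?J0; ring.
Qed.

Lemma SR_C_vec_stem : SR_C J D (svec D f) ->
  forall z, D z -> vec_stem F z = biq 0 (Jcomp (F z) * (qb J)%:C%C)
    (Jcomp (F z) * (qc J)%:C%C) (Jcomp (F z) * (qd J)%:C%C).
Proof.
move=> [G [_ _ iG rG]] z Dz.
have E := stem_unique (svec_induces cD sF iF) iG Dz.
have /CplaneP := rG z Dz; rewrite -E !biqE => -[h2 h3 h4].
have JE : Jcomp (vec_stem F z) = Jcomp (F z) by rewrite /Jcomp !biqE.
by rewrite /vec_stem h2 h3 h4 JE.
Qed.

Lemma vnorm_Jcomp z : vec_stem F z = biq 0 (Jcomp (F z) * (qb J)%:C%C)
    (Jcomp (F z) * (qc J)%:C%C) (Jcomp (F z) * (qd J)%:C%C) ->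
  vnorm (F z) = Jcomp (F z) ^+ 2.
Proof.
have [_ J1] := J_coords; move=> /biq_inj [_ h2 h3 h4].
rewrite /vnorm {1}h2 {1}h3 {1}h4 !exprMn -!mulrDr -!rmorphXn -!rmorphD /=.
by rewrite J1 mulr1.
Qed.

Lemma Jcomp_cdiff z : D z -> exists c, cdiff (fun x => Jcomp (F x)) z c.
Proof.
move=> Dz; have [_ [b hb] [c hc] [d hd]] := holomorphic_coords hF Dz.
by eexists; exact: cdiffD (cdiffD (cdiffM hb (cdiff_cst _ _))
  (cdiffM hc (cdiff_cst _ _))) (cdiffM hd (cdiff_cst _ _)).
Qed.

Lemma Jcomp_conj z : D z -> Jcomp (F (conjC2 z)) = conjc (Jcomp (F z)).
Proof.
move=> Dz; have [_ h2 h3 h4] := (stem_coordP D F).1 sF z Dz.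
by rewrite /Jcomp h2 h3 h4 !conjcD !conjcM !conjc_real.
Qed.

(** If v = u J then vnorm = u^2 and m = i u is a holomorphic choice of square
    root, so that B u = (e^(a + i u) - e^(a - i u)) / (2 i) is holomorphic. *)
Lemma SR_C_exp : SR_C J D (svec D f) -> SR_C J D (sexp D f).
Proof.
move=> hJ; have vJ := SR_C_vec_stem hJ.
pose u z := Jcomp (F z); pose p z := biq_a (F z) + 'i%C * u z.
pose q z := biq_a (F z) + (- 'i%C) * u z.
pose A z := 2^-1 * (cexp (p z) + cexp (q z)).
pose S z := (2 * 'i%C)^-1 * (cexp (p z) + (-1) * cexp (q z)).
exists (fun z => biq (A z) (S z * (qb J)%:C%C) (S z * (qc J)%:C%C) (S z * (qd J)%:C%C)).
have i0 : 'i%C != 0 :> R[i] by rewrite eq_complex /= oner_eq0 andbF.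
split.
- apply/stem_coordP => z Dz.
  have [ha _ _ _] := (stem_coordP D F).1 sF z Dz.
  have pq : p (conjC2 z) = conjc (q z).
    by rewrite /p /q /u ha Jcomp_conj // conjcD conjcM conjcN conjci opprK.
  have qp : q (conjC2 z) = conjc (p z).
    by rewrite /p /q /u ha Jcomp_conj // conjcD conjcM conjci.
  have Sc : S (conjC2 z) = conjc (S z).
    rewrite /S pq qp !cexp_conj conjcM conjcD conjcM conjc_inv conjcM conjci.
    rewrite conjcN conjc1 conjc_nat mulrN invrN; ring.
  rewrite !biqE !(conjcM (S z)) !conjc_real Sc; split=> //.
  by rewrite /A pq qp !cexp_conj conjcM conjcD conjc_inv conjc_nat addrC.
- apply: holomorphic_biq => z Dz; have [[c hc] _ _ _] := holomorphic_coords hF Dz.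
  have [d hd] := Jcomp_cdiff Dz.
  have [p' hp] : exists c, cdiff p z c.
    by eexists; exact: cdiffD hc (cdiffM (cdiff_cst _ _) hd).
  have [q' hq] : exists c, cdiff q z c.
    by eexists; exact: cdiffD hc (cdiffM (cdiff_cst _ _) hd).
  have [S' hS] : exists c, cdiff S z c.
    by eexists; exact: cdiffM (cdiff_cst _ _)
      (cdiffD (cdiff_exp hp) (cdiffM (cdiff_cst _ _) (cdiff_exp hq))).
  split; eexists; [|exact: cdiffM hS (cdiff_cst _ _)..].
  exact: cdiffM (cdiff_cst _ _) (cdiffD (cdiff_exp hp) (cdiff_exp hq)).
- have hm z : D z -> ('i%C * u z) ^+ 2 = - vnorm (F z).
    by move=> /vJ/vnorm_Jcomp ->; rewrite exprMn sqr_i mulN1r.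
  move=> x y I Dz II; rewrite (sexp_induces cD sF iF hm Dz II) /exp_stem.
  set z := (x, y); have /biq_inj[_ h2 h3 h4] := vJ z Dz.
  have BS : exp_coefB (biq_a (F z)) ('i%C * u z) * u z = S z.
    rewrite /exp_coefB mulf_eq0 (negbTE i0) /= /S /p /q.
    have [u0|u0] := eqVneq (u z) 0.
      by rewrite u0 !mulr0 !addr0 mulN1r subrr mulr0.
    by rewrite mulN1r mulNr; field; rewrite u0 i0.
  by rewrite h2 h3 h4 !mulrA -/(u z) BS /exp_coefA /A /p /q mulNr.
- by move=> z _; exact: biq_Cplane.
Qed.

(** The component u along J satisfies u^2 = n^2 pi^2, so it takes its values in the
    discrete set pi Z and is constant, even if the sign of u is not known
    a priori. *)
Lemma Jcomp_const z0 : D z0 -> SR_C J D (svec D f) -> (exists n : int,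
    forall z, D z -> vnorm (F z) = (n%:~R ^+ 2 * pi ^+ 2)%:C%C) ->
  exists n : int, forall z, D z -> vec_stem F z = ((n%:~R * pi) *: J, 0).
Proof.
move=> Dz0 hJ [n hn]; have vJ := SR_C_vec_stem hJ.
have val z : D z -> exists k : int, Jcomp (F z) = (k%:~R * pi)%:C%C.
  move=> Dz; have := hn z Dz; rewrite (vnorm_Jcomp (vJ z Dz)).
  rewrite -exprMn rmorphXn => /eqP; rewrite eqf_sqr => /orP[/eqP->|/eqP->].
    by exists n.
  by exists (- n); rewrite intrN mulNr rmorphN.
have [k hk] := val _ Dz0.
have cst : forall z, D z -> Jcomp (F z) = Jcomp (F z0).
  apply: (@circ_locally_constant R D (fun z => Jcomp (F z) = Jcomp (F z0))
    cD oD connD _ _ z0) => //.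
  - by move=> x Dx h; rewrite Jcomp_conj // h hk; exact: conjc_real.
  - move=> x Dx.
    have : \forall y \near x, Jcomp (F y) = Jcomp (F x).
      apply: (@discrete_locally_constant R (fun y => Jcomp (F y)) x pi).
      + exact: pi_gt0.
      + exact: Jcomp_cdiff.
      + by apply: filterS (circ_open cD oD Dx) => y /val.
    by apply: filterS => y ->.
have [J0 _] := J_coords.
exists k => z Dz; rewrite vJ // cst // hk.
by congr pair; apply: quat_eq; rewrite /= ?J0; ring.
Qed.

(** Off the line spanned by J the C_J-valuedness of A + B v forces B = 0. This is
    an open condition, so vnorm is locally equal to n^2 pi^2, hence globally by
    [circ_identity], and then the exponential is slice-preserving. *)
Lemma SR_C_svec : SR_C J D (sexp D f) -> ~ SR_real D (sexp D f) ->
  SR_C J D (svec D f).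
Proof.
move=> [G [_ _ iG rG]] nr.
have inJ z : D z -> exp_coefB (biq_a (F z)) (m z) != 0 ->
    [/\ biq_b (F z) = Jcomp (F z) * (qb J)%:C%C, biq_c (F z) = Jcomp (F z) * (qc J)%:C%C &
        biq_d (F z) = Jcomp (F z) * (qd J)%:C%C].
  move=> Dz B0; have /CplaneP := rG z Dz.
  rewrite -(stem_unique sexp_stem iG Dz).
  set B := exp_coefB _ _ in B0 *.
  have -> : Jcomp (exp_stem F m z) = B * Jcomp (F z).
    by rewrite /Jcomp /exp_stem !biqE -/B; ring.
  rewrite /exp_stem !biqE -/B -!mulrA => -[h2 h3 h4].
  by split; apply: (mulfI B0).
have inJ_all z : D z -> [/\ biq_b (F z) = Jcomp (F z) * (qb J)%:C%C,
    biq_c (F z) = Jcomp (F z) * (qc J)%:C%C & biq_d (F z) = Jcomp (F z) * (qd J)%:C%C].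
  move=> Dz; apply: contrapT => nJ; apply: nr.
  have nz (phi : CC -> R[i]) : (exists c, cdiff phi z c) -> phi z != 0 ->
      \forall x \near z, phi x != 0.
    move=> [c dc] p0; have [cr ci] := cdiff_continuous dc.
    have : (Re (phi z) != 0) || (Im (phi z) != 0).
      apply: contra_neqT p0; rewrite negb_or !negbK => /andP[/eqP h1 /eqP h2].
      exact: eqC.
    case/orP=> h.
      have : \forall x \near z, Re (phi x) != 0 by exact: cvgr_neq0 cr h.
      by apply: filterS => x; apply: contra_neq => ->.
    have : \forall x \near z, Im (phi x) != 0 by exact: cvgr_neq0 ci h.
    by apply: filterS => x; apply: contra_neq => ->.
  have [_ [b hb] [c hc] [d hd]] := holomorphic_coords hF Dz.
  have [u hu] := Jcomp_cdiff Dz.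
  have dif (phi : CC -> R[i]) k (t : R[i]) : cdiff phi z k ->
      exists c, cdiff (fun x => phi x + - t * Jcomp (F x)) z c.
    by move=> hp; eexists; exact: cdiffD hp (cdiffM (cdiff_cst _ _) hu).
  have Bz : \forall x \near z, ~ [/\ biq_b (F x) = Jcomp (F x) * (qb J)%:C%C,
      biq_c (F x) = Jcomp (F x) * (qc J)%:C%C & biq_d (F x) = Jcomp (F x) * (qd J)%:C%C].
    have eqN (s t v : R[i]) : s = t * v -> s + - v * t = 0.
      by move=> ->; ring.
    have [e2|e2] := eqVneq (biq_b (F z)) (Jcomp (F z) * (qb J)%:C%C); last first.
      have := nz _ (dif _ _ (qb J)%:C%C hb).
      rewrite mulNr subr_eq0 [_ * Jcomp _]mulrC => /(_ e2).
      by apply: filterS => x /eqP hx [/eqN h _ _]; apply: hx.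
    have [e3|e3] := eqVneq (biq_c (F z)) (Jcomp (F z) * (qc J)%:C%C); last first.
      have := nz _ (dif _ _ (qc J)%:C%C hc).
      rewrite mulNr subr_eq0 [_ * Jcomp _]mulrC => /(_ e3).
      by apply: filterS => x /eqP hx [_ /eqN h _]; apply: hx.
    have [e4|e4] := eqVneq (biq_d (F z)) (Jcomp (F z) * (qd J)%:C%C); last first.
      have := nz _ (dif _ _ (qd J)%:C%C hd).
      rewrite mulNr subr_eq0 [_ * Jcomp _]mulrC => /(_ e4).
      by apply: filterS => x /eqP hx [_ _ /eqN h]; apply: hx.
    by exfalso; exact: nJ.
  have Nn : \forall x \near z, exists2 n : int, n != 0 &
      vnorm (F x) = (n%:~R ^+ 2 * pi ^+ 2)%:C%C.
    have := circ_open cD oD Dz; apply: filterS2 Bz => x nx Dx.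
    apply: (exp_coefB_vnorm (sqrt_vnorm x)); apply/eqP/negPn/negP => B0.
    by apply: nx; exact: inJ.
  have [n n0 En] := nbhs_singleton Nn.
  have loc : \forall x \near z, vnorm (F x) = vnorm (F z).
    apply: (@discrete_locally_constant R (fun y => vnorm (F y)) z (pi ^+ 2)).
    + by rewrite exprn_gt0 // pi_gt0.
    + exact: vnorm_cdiff.
    + by apply: filterS Nn => y [k _ ->]; exists (k ^+ 2); rewrite rmorphXn.
  apply: (SR_real_of_vnorm n0).
  apply: (circ_identity cD oD connD vnorm_cdiff vnorm_conj Dz).
  by rewrite -En.
exists (vec_stem F); split.
- exact: vec_stem_stem.
- apply: holomorphic_biq => z Dz; have [_ h2 h3 h4] := holomorphic_coords hF Dz.
  by split=> //; exists 0; exact: cdiff_cst.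
- exact: svec_induces.
- move=> z Dz; have [h2 h3 h4] := inJ_all z Dz; rewrite /vec_stem h2 h3 h4.
  exact: biq_Cplane.
Qed.

End SliceExponentialReal.

Theorem proposition4p10 (R : realType) (D : set (R * R)) (Omega : set (quat R))
    (f : quat R -> quat R)
    (hD : conj_invariant D) (hOmega : Omega = circularization D)
    (Omega_open : open Omega) (Omega_connected : connected Omega)
    (Omega_neq0 : Omega !=set0) (hf : SR D f) :
  (SR_real D (sexp D f) <->
     (forall q, Omega q -> svec D f q = 0) \/
     (exists2 c : R, calZ c &
        forall q, Omega q -> ssym D (svec D f) q = c%:A)) /\
  (forall J : quat R, imag_units J ->
     (SR_C J D (sexp D f) /\ ~ SR_real D (sexp D f) <->
      SR_C J D (svec D f) /\
      ~ (exists n : int, forall q, Omega q ->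
           svec D f q = (n%:~R * pi) *: J))).
Proof.
subst Omega; case: hf => F [sF hF iF _].
have [_ [x0 [y0 [_ [Dz0 _ _]]]]] := Omega_neq0.
have vecP k : (forall q, circularization D q -> svec D f q = k) <->
    forall z, D z -> vec_stem F z = (k, 0).
  rewrite -induces_cstP; have iv := svec_induces hD sF iF; split=> [h z Dz|h].
    exact: stem_unique iv h _ Dz.
  by move=> x y I Dz II; rewrite (iv x y I Dz II) h.
have symP c : (forall q, circularization D q -> ssym D (svec D f) q = c%:A) <->
    forall z, D z -> vnorm (F z) = c%:C%C.
  have cE : (c%:A, 0) = biq c%:C%C 0 0 0 :> quat R * quat R.
    by congr pair; apply: quat_eq; rewrite /= ?mulr1 ?mulr0.
  rewrite -induces_cstP cE; have iy := ssym_svec_induces hD sF iF.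
  split=> [h z Dz|h x y I Dz II]; last by rewrite (iy x y I Dz II) h.
  by have /biq_inj[] := stem_unique iy h Dz.
have realP : SR_real D (sexp D f) <->
    (forall z, D z -> vec_stem F z = 0) \/
    exists2 n : int, n != 0 &
      forall z, D z -> vnorm (F z) = (n%:~R ^+ 2 * pi ^+ 2)%:C%C.
  split; first exact: real_const hD Omega_open Omega_connected sF hF iF _ Dz0.
  by case=> [|[n n0]]; [exact: SR_real_of_vec0 | exact: SR_real_of_vnorm].
split.
  rewrite realP; split=> -[h|].
  - by left; apply/vecP.
  - by case=> n n0 hn; right; exists (n%:~R ^+ 2 * pi ^+ 2); [exists n | apply/symP].
  - by left; apply/vecP.
  - by case=> _ [n n0 ->] /symP h; right; exists n.
move=> J unitJ; split.
  move=> [hJ nr]; split; first exact: (SR_C_svec hD Omega_open Omega_connected sF hF iF unitJ).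
  move=> [n /vecP hn]; apply: nr; apply/realP.
  have [n0|n0] := eqVneq n 0.
    by left=> z Dz; rewrite hn // n0 mul0r scale0r.
  right; exists n => // z Dz; have [J0 J1] := J_coords unitJ.
  have := hn z Dz; rewrite /vec_stem => e.
  have -> : vnorm (F z) = vnorm (vec_stem F z) by rewrite /vnorm !biqE.
  rewrite /vec_stem e; apply: eqC; rewrite /vnorm !exprS !expr0 !mulr1 !ReImE /=.
    transitivity (n%:~R ^+ 2 * pi ^+ 2 * (qb J ^+ 2 + qc J ^+ 2 + qd J ^+ 2)).
      by ring.
    by rewrite J1 mulr1.
  by rewrite ?mulr0 ?mul0r ?addr0.
move=> [hJ nc]; split; first exact: (SR_C_exp hD sF hF iF unitJ).
move=> /realP [h|[n n0 hn]]; apply: nc.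
  by exists 0; apply/vecP => z Dz; rewrite h // mul0r scale0r.
have [|k hk] := Jcomp_const hD Omega_open Omega_connected sF hF iF unitJ Dz0 hJ.
  by exists n.
by exists k; apply/vecP.
Qed.
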